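(* Let $p=p(n)\in[0,1]$ and let $G(n,p)$ be the Erdős–Rényi random graph. The following hold asymptotically almost surely (a.a.s.) as $n\to\infty$: (i) If $p\in(0,1)$ is a constant, then $\mathbf{rw}(G(n,p))=\lceil \frac n3\rceil-O(1)$; that is, there is a constant $C$ (depending only on $p$) such that a.a.s. $\left|\mathbf{rw}(G(n,p))-\lceil \frac n3\rceil\right|\le C$. (ii) If $\frac1n\ll p\le\frac12$ (that is, $p(n)\le \frac12$ and $n\,p(n)\to\infty$), then $\mathbf{rw}(G(n,p))=\lceil\frac n3\rceil-o(n)$; that is, for every $\varepsilon>0$, a.a.s. $\left|\mathbf{rw}(G(n,p))-\lceil \frac n3\rceil\right|\le \varepsilon n$. (iii) If $p=c/n$ for a constant $c>1$, then there is a constant $r=r(c)>0$, depending only on $c$, such that a.a.s. $\mathbf{rw}(G(n,p))\ge rn$. (iv) If $p\le c/n$ for a constant $c<1$, then a.a.s. $\mathbf{rw}(G(n,p))\le 2$.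
   Context: Graphs are finite and have neither loops nor parallel edges. $G(n,p)$ is the random graph on vertex set $\{1,\dots,n\}$ in which each unordered pair of distinct vertices is adjacent with probability $p$, independently of all other pairs ($p$ may depend on $n$; when $p=c/n$, only $n$ large enough that $p\le 1$ is considered). A property holds asymptotically almost surely (a.a.s.) if the probability that $G(n,p)$ has it tends to $1$ as $n\to\infty$. Rank-width: for disjoint $V_1,V_2\subseteq V(G)$, let $N_{V_1,V_2}$ be the $|V_1|\times|V_2|$ matrix over $\mathbb F_2=\{0,1\}$ with rows labeled by $V_1$ and columns by $V_2$, whose $(v_1,v_2)$ entry is $1$ iff $v_1$ and $v_2$ are adjacent in $G$. The cutrank is $\rho_G(V_1,V_2)=\mathbf{rank}(N_{V_1,V_2})$ (rank over $\mathbb F_2$). A tree is subcubic if every vertex has degree $1$ or $3$. A rank-decomposition of $G$ is a pair $(T,L)$ of a subcubic tree $T$ and a bijection $L$ from $V(G)$ to the set of leaves of $T$. Deleting an edge $uv$ of $T$ leaves two components $C_u\ni u$ and $C_v\ni v$; let $A_{uv}$ and $B_{uv}$ be the sets of vertices of $G$ mapped by $L$ to leaves of $T$ in $C_u$ and in $C_v$, respectively. Then $\mathbf{rw}(G)=\min_{(T,L)}\max_{uv\in E(T)}\rho_G(A_{uv},B_{uv})$, the minimum being over all rank-decompositions of $G$; $\mathbf{rw}(G)=0$ if $|V(G)|\le1$. *)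

(* Defs.v *)
From mathcomp Require Import all_boot all_order all_algebra.
From mathcomp Require Import all_classical all_reals all_analysis.

Set Implicit Arguments.
Unset Strict Implicit.
Unset Printing Implicit Defensive.

Import Order.TTheory GRing.Theory Num.Theory.
Import numFieldNormedType.Exports.

Local Open Scope ring_scope.

Definition sgraph (V : finType) :=
  {E : {set {set V}} | [forall e in E, #|e| == 2%N]}.

Section Graphs.
Variable V : finType.
Implicit Type G : sgraph V.

(* Irreflexive, since [set x; x] is a singleton. *)
Definition adj G : rel V := fun x y => [set x; y] \in val G.

Definition degree G (x : V) : nat := #|[set y | adj G x y]|.

Definition leaves G : {set V} := [set x | degree G x == 1%N].

(* A closed walk x, y, x is a ucycle of size 2; genuine cycles have size at
   least 3. *)
Definition is_tree G : Prop :=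
  [/\ (0 < #|V|)%N,
      forall x y : V, connect (adj G) x y
    & forall c : seq V, ucycle (adj G) c -> (size c < 3)%N].

Definition subcubic G : Prop :=
  forall x : V, degree G x = 1%N \/ degree G x = 3%N.

Definition component_del G (u v w : V) : {set V} :=
  [set x | connect [rel a b | adj G a b && ([set a; b] != [set u; v])] w x].

Definition cutrank G (V1 V2 : {set V}) : nat :=
  \rank (\matrix_(i < #|V1|, j < #|V2|)
           ((adj G (enum_val i) (enum_val j))%:R : 'F_2)).

End Graphs.

Record rank_decomposition (V : finType) := RankDecomposition {
  rd_node : finType;
  rd_tree : sgraph rd_node;
  rd_leaf : V -> rd_node;
  rd_is_tree : is_tree rd_tree;
  rd_subcubic : subcubic rd_tree;
  rd_leaf_inj : injective rd_leaf;
  rd_leaf_onto : [set rd_leaf x | x : V] = leaves rd_tree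
}.

Section RankWidth.
Variable V : finType.

(* For w = u and w = v these are the sets A_uv and B_uv. *)
Definition rd_side (D : rank_decomposition V) (u v w : rd_node D) : {set V} :=
  [set x | rd_leaf D x \in component_del (rd_tree D) u v w].

Definition rd_width (G : sgraph V) (D : rank_decomposition V) : nat :=
  \max_(e : rd_node D * rd_node D | adj (rd_tree D) e.1 e.2)
     cutrank G (rd_side e.1 e.2 e.1) (rd_side e.1 e.2 e.2).

Definition is_rd_width (G : sgraph V) : pred nat :=
  fun k => `[< exists D : rank_decomposition V, rd_width G D = k >].

(* A graph with at least two vertices has a rank-decomposition (along a
   caterpillar, for instance), so the last branch is never reached. *)
Definition rank_width (G : sgraph V) : nat :=
  if (#|V| <= 1)%N then 0%N
  else if pselect (exists k, is_rd_width G k) is left ex then ex_minn ex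
  else 0%N.

End RankWidth.

Section RandomGraph.
Variable R : realType.

(* The product runs over the unordered pairs of distinct vertices. *)
Definition Gnp_weight (n : nat) (p : R) (G : sgraph 'I_n) : R :=
  \prod_(e : {set 'I_n} | #|e| == 2%N) (if e \in val G then p else 1 - p).

Definition Gnp_prob (n : nat) (p : R) (A : pred (sgraph 'I_n)) : R :=
  \sum_(G : sgraph 'I_n | A G) Gnp_weight p G.

(* Gnp_prob (p n) is a probability whenever 0 <= p n <= 1. Only large n matter
   for the limit, so it is harmless that p n = c / n, with c > 1, is not in
   [0, 1] for finitely many n. *)
Definition aas (p : nat -> R) (A : forall n, pred (sgraph 'I_n)) : Prop :=
  (Gnp_prob (p n) (@A n) @[n --> \oo] --> (1 : R))%classic.


End RandomGraph.

(* Main.v *)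
(** Upper bound n/3 + O(1): split V into three parts of about n/3 vertices, lay
    each part out along a caterpillar and glue the three caterpillars at a
    vertex; every cut then has a side with at most n/3 + 2 vertices.

    Lower bounds: for every vertex set X, a rank-decomposition of width r has a
    cut (A, B) of rank at most r with at least a third of X on either side.

    (i), (ii) If the rank of the A x B adjacency matrix is at most r, then r rows
    I and r columns J spanning the row and the column space determine the
    remaining (|A| - r)(|B| - r) entries.  Given (A, I, J) this has probability
    at most max(p, 1-p)^((|A|-r)(|B|-r)), and there are at most 8^n triples.

    (iii) A.a.s. every small set of vertices touches few edges, so that a cut of
    small rank is crossed by few edges.  Cutting repeatedly, a decomposition of
    small width thus splits the graph into pieces of at most D vertices (D a
    small fraction of n) by removing few edges.  Take j least such that the
    pieces' components meeting {1, ..., j} cover a set W of at least D vertices: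
    then |W| < 2D, few edges leave W, and W has a spanning forest rooted in
    {1, ..., j}.  The expected number of such pairs (forest, W) is at most
    n^2 max_w (c e^(1 - c + o(1)))^w, which is exponentially small as
    c e^(1-c) < 1 for c > 1.

    (iv) A.a.s. no path has two extra edges joining its two end vertices to
    vertices of the path (the expected number of such configurations on k
    vertices is at most k^2 c^(k+1) / n).  In a graph without them, vertices of
    degree at most 1 can be peeled off, and once there are none, a longest path
    spans a component which is a cycle; the cuts so obtained have rank at
    most 2. *)

Require Import Defs.
From mathcomp Require Import all_boot all_order all_algebra.
From mathcomp Require Import all_classical all_reals all_analysis.
From mathcomp Require Import zify ring lra.
(* Imported again so that [setUC], [subsetP], etc. are about finite sets. *)
From mathcomp Require Import fintype finset.
Import Order.TTheory GRing.Theory Num.Theory.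
Import numFieldNormedType.Exports.
Local Open Scope ring_scope.

Set Implicit Arguments.
Unset Strict Implicit.
Unset Printing Implicit Defensive.

(** * Walks and adjacency *)

Lemma connect_invariant (T : finType) (e : rel T) (P : T -> Prop) (x y : T) :
  P x -> (forall a b, P a -> e a b -> P b) -> connect e x y -> P y.
Proof.
move=> Px Pe /connectP[p]; elim: p x Px => [|z p IH] x Px /=; first by move=> _ ->.
by move=> /andP[exz pz] ey; apply: (IH z) => //; apply: Pe exz.
Qed.

Lemma adj_sym (V : finType) (G : sgraph V) : symmetric (adj G).
Proof. by move=> x y; rewrite /adj setUC. Qed.

Lemma adj_irr (V : finType) (G : sgraph V) x : adj G x x = false.
Proof.
apply/negP => h; have /forall_inP/(_ _ h) := valP G.
by rewrite setUid cards1.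
Qed.

Lemma adj_neq (V : finType) (G : sgraph V) x y : adj G x y -> x != y.
Proof. by apply: contraTneq => ->; rewrite adj_irr. Qed.

Lemma eq_set2 (V : finType) (a b c d : V) :
  [set a; b] = [set c; d] -> (a = c /\ b = d) \/ (a = d /\ b = c).
Proof.
move=> e; have := set21 a b; have := set22 a b; rewrite e !inE.
have := set21 c d; have := set22 c d; rewrite -e !inE.
by do 4!(case/orP => /eqP ?); subst; auto.
Qed.

(** * Cutrank *)

Section CutRank.
Variables (V : finType).
Implicit Types (G : sgraph V) (A B I J S : {set V}).

Local Notation "x ~[ G ] y" := ((adj G x y)%:R : 'F_2) (at level 35).

(** A maximal independent set of rows spans all rows. Labelling rows and coefficients by vertices
    spares the later arguments any matrix indices. *)
Lemma cutrank_span G A B : exists I (c : V -> V -> 'F_2),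
  [/\ I \subset A, (#|I| <= cutrank G A B)%N &
    forall a b, a \in A -> b \in B -> a ~[G] b = \sum_(i in I) c a i * i ~[G] b].
Proof.
rewrite /cutrank; set M := \matrix_(i, j) _.
have /submxP[D eD] : (M <= rowsub (maxrankfun M) M)%MS by rewrite eq_maxrowsub.
pose g k := enum_val (maxrankfun M k).
exists [set g k | k : 'I_(\rank M)].
(* Matrix coefficients are moved to vertices by summing over fibres, so repeated values of [g] do no
   harm. *)
exists (fun a i => \sum_(r | enum_val r == a) \sum_(k | g k == i) D r k); split.
- by apply/subsetP => i /imsetP[k _ ->]; apply: enum_valP.
- by apply: leq_trans (leq_imset_card _ _) _; rewrite card_ord.
move=> a b aA bB.
have ra : enum_val (enum_rank_in aA a) = a by rewrite enum_rankK_in.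
have rb : enum_val (enum_rank_in bB b) = b by rewrite enum_rankK_in.
have -> : a ~[G] b = M (enum_rank_in aA a) (enum_rank_in bB b) by rewrite mxE ra rb.
rewrite {1}eD mxE (partition_big g (mem [set g k | k : 'I_(\rank M)])) /=; last first.
  by move=> k _; rewrite imset_f.
apply: eq_bigr => i _.
rewrite (big_pred1 (enum_rank_in aA a)) => [|r]; last first.
  by apply/eqP/eqP => [e|->] //; apply: enum_val_inj; rewrite ra.
rewrite mulr_suml; apply: eq_bigr => k /eqP <-.
by rewrite !mxE rb.
Qed.

(** The hypothesis factors the adjacency matrix through [#|I|] dimensions. *)
Lemma cutrank_le G A B I (c d : V -> V -> 'F_2) :
  (forall a b, a \in A -> b \in B -> a ~[G] b = \sum_(i in I) c a i * d i b) ->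
  (cutrank G A B <= #|I|)%N.
Proof.
move=> e; rewrite /cutrank; set M := \matrix_(i, j) _.
have -> : M = (\matrix_(i < #|A|, k < #|I|) c (enum_val i) (enum_val k)) *m
              (\matrix_(k < #|I|, j < #|B|) d (enum_val k) (enum_val j)).
  apply/matrixP => i j; rewrite !mxE e ?enum_valP // big_enum_val.
  by apply: eq_bigr => k _; rewrite !mxE.
exact: leq_trans (mxrankM_maxl _ _) (rank_leq_col _).
Qed.

Lemma cutrank_sym G A B : cutrank G A B = cutrank G B A.
Proof.
rewrite /cutrank -mxrank_tr; congr (\rank _).
by apply/matrixP => i j; rewrite !mxE adj_sym.
Qed.

(** Rows outside [A'] and columns outside [B'] vanish, so spanning rows of the smaller matrix also
    span the larger one. *)
Lemma cutrank_sub G A B A' B' : A' \subset A -> B' \subset B ->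
  (forall a b, a \in A -> b \in B -> adj G a b -> (a \in A') && (b \in B')) ->
  (cutrank G A B <= cutrank G A' B')%N.
Proof.
move=> /subsetP sA /subsetP sB h.
have [I [c [/subsetP sI leI e]]] := cutrank_span G A' B'; apply: leq_trans leI.
apply: (@cutrank_le _ _ _ _ (fun a i => if a \in A' then c a i else 0) (fun i b => i ~[G] b)).
move=> a b aA bB; have [aA'|aA'] := boolP (a \in A'); last first.
  rewrite big1 => [|i _]; last by rewrite mul0r.
  by case: (boolP (adj G a b)) => // /(h _ _ aA bB); rewrite (negPf aA').
have [bB'|bB'] := boolP (b \in B'); first exact: e.
have nb i : i \in A -> i ~[G] b = 0.
  by move=> iA; case: (boolP (adj G i b)) => // /(h _ _ iA bB); rewrite (negPf bB') andbF.
by rewrite nb // big1 // => i iI; rewrite nb ?mulr0 // sA // sI.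
Qed.

Lemma cutrank_leq_left G A B : (cutrank G A B <= #|A|)%N.
Proof. exact: rank_leq_row. Qed.

Lemma cutrank_leq_right G A B : (cutrank G A B <= #|B|)%N.
Proof. exact: rank_leq_col. Qed.

Lemma cutrank_cover G A B S :
  (forall a b, a \in A -> b \in B -> adj G a b -> a \in S) -> (cutrank G A B <= #|S|)%N.
Proof.
move=> h; apply: leq_trans (subset_leq_card (subsetIl S A)).
apply: leq_trans (cutrank_leq_left G (S :&: A) B).
apply: cutrank_sub => [||a b aA bB ab]; rewrite ?subsetIr //.
by rewrite inE aA bB (h a b).
Qed.

(* Both adjacency matrices are determined by the rows [I] and the columns [J]:
   with coefficient matrices [c'] for G' and [d] for G,
   N' = c' N'_I = c' N_I = c' N_IJ d = c' N'_IJ d = N'_J d = N_J d = N. *)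
Lemma cut_unique G G' A B I J (c c' d d' : V -> V -> 'F_2) :
  I \subset A -> J \subset B ->
  (forall a b, a \in A -> b \in B -> a ~[G'] b = \sum_(i in I) c' a i * i ~[G'] b) ->
  (forall a b, a \in A -> b \in B -> a ~[G] b = \sum_(j in J) d b j * a ~[G] j) ->
  (forall a b, a \in A -> b \in B -> (a \in I) || (b \in J) -> adj G a b = adj G' a b) ->
  forall a b, a \in A -> b \in B -> adj G a b = adj G' a b.
Proof.
move=> /subsetP sI /subsetP sJ row col ag a b aA bB.
suff : a ~[G] b = a ~[G'] b by do 2!case: adj.
rewrite row // col //.
transitivity (\sum_(j in J) \sum_(i in I) d b j * (c' a i * i ~[G] j)).
  apply: eq_bigr => j jJ; rewrite -mulr_sumr; congr (_ * _).
  rewrite (ag _ _ aA (sJ _ jJ)) ?jJ ?orbT // row ?sJ //.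
  by apply: eq_bigr => i iI; rewrite ag ?sI ?sJ ?iI.
rewrite exchange_big; apply: eq_bigr => i iI /=.
rewrite -ag ?sI ?iI // col ?sI // mulr_sumr; apply: eq_bigr => j _.
by rewrite mulrCA.
Qed.
End CutRank.

(** * Balanced cuts of rank-decompositions *)

Local Open Scope nat_scope.

Section TreeCuts.
Variables (N : finType) (T : sgraph N).
Hypothesis treeT : is_tree T.
Local Notation comp := (component_del T).
Local Notation del u v := [rel a b | adj T a b && ([set a; b] != [set u; v])].

Lemma del_connect_sym u v : connect_sym (del u v).
Proof.
by apply: sym_connect_sym => a b /=; rewrite adj_sym (setUC [set b]).
Qed.

Lemma component_del_refl u v w : w \in comp u v w.
Proof. by rewrite inE connect0. Qed.

Lemma component_del_step u v w x y : x \in comp u v w -> adj T x y ->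
  [set x; y] != [set u; v] -> y \in comp u v w.
Proof.
rewrite !inE => cx axy ne; apply: connect_trans cx _.
by apply: connect1; rewrite /= axy ne.
Qed.

Lemma component_del_cover u v x : adj T u v -> (x \in comp u v u) || (x \in comp u v v).
Proof.
move=> auv; case: treeT => _ conT _.
apply: (connect_invariant (P := fun x => (x \in comp u v u) || (x \in comp u v v)) _ _ (conT u x)).
  by rewrite component_del_refl.
move=> a b ha ab; have [/eq_set2|ne] := eqVneq [set a; b] [set u; v].
  by case=> -[_ ->]; rewrite component_del_refl ?orbT.
by case/orP: ha => h; rewrite (component_del_step h ab ne) ?orbT.
Qed.

(** A simple path from [u] to [v] avoiding the edge [uv] would close up with that edge to a
    cycle. *)
Lemma component_del_sep u v : adj T u v -> v \notin comp u v u.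
Proof.
move=> auv; apply/negP; rewrite inE => /connectP[p pp vE].
case: treeT => _ _ acyc; case/shortenP: pp vE => p' pp' up' _ vE.
have := acyc (u :: p'); rewrite /ucycle up' andbT /= rcons_path.
have -> : path (adj T) u p'.
  by apply: sub_path pp' => a b /andP[].
rewrite -vE adj_sym auv /= => /(_ isT).
(* Acyclicity leaves at most one vertex in [p']: none would make [uv] a loop, and one would make the
   path the deleted edge. *)
case: p' pp' vE {up'} => [|x [|y p']] //=.
  by move=> _ vu; move: auv; rewrite vu adj_irr.
by move=> h e; move: h; rewrite -e eqxx andbF.
Qed.

Lemma component_del_disj u v x : adj T u v -> x \in comp u v u -> x \in comp u v v -> False.
Proof.
move=> auv xu xv; have /negP := component_del_sep auv; apply; move: xu xv.
rewrite !inE => cu; rewrite del_connect_sym => cv; exact: connect_trans cu cv.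
Qed.

Lemma component_delC u v w : comp u v w = comp v u w.
Proof. by rewrite /component_del (setUC [set u]). Qed.

(** The strict inclusion makes a walk away from [u] terminate. *)
Lemma component_del_sub u v a : adj T u v -> adj T v a -> a != u ->
  comp v a a \proper comp u v v.
Proof.
move=> auv ava neau; have vNa : v \notin comp v a a.
  by rewrite component_delC component_del_sep // adj_sym.
apply/properP; split; last by exists v; rewrite ?component_del_refl.
apply/subsetP => x; rewrite inE => cx.
(* Membership in both components is the invariant: staying beyond [a] keeps the walk off [v], hence
   off the edge [uv]. *)
suff [] : x \in comp v a a /\ x \in comp u v v by [].
apply: (connect_invariant (P := fun x => x \in comp v a a /\ x \in comp u v v) _ _ cx).
  split; first exact: component_del_refl.
  apply: component_del_step (component_del_refl _ _ _) ava _.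
  apply/eqP => /eq_set2[][e1 e2]; last by rewrite e2 eqxx in neau.
  by move: auv; rewrite e1 adj_irr.
move=> b c [b1 b2] /andP[abc ne].
split; first exact: component_del_step b1 abc ne.
apply: (component_del_step b2 abc).
apply/eqP => /eq_set2[][e1 e2]; last by move: b1; rewrite e1 (negPf vNa).
by have := component_del_step b1 abc ne; rewrite e2 (negPf vNa).
Qed.

Lemma component_del_branch u v a b x : adj T u v -> adj T v a -> adj T v b ->
    (forall c, adj T v c -> c \in [:: u; a; b]) -> x \in comp u v v ->
  [|| x == v, x \in comp v a a | x \in comp v b b].
Proof.
move=> auv ava avb hN; rewrite inE => cx.
apply: (connect_invariant (P := fun x => [|| x == v, x \in comp v a a | x \in comp v b b]) _ _ cx).
  by rewrite eqxx.
have step c y z : adj T y z -> y \in comp v c c -> (z == v) || (z \in comp v c c).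
  move=> ayz yc; have [/eq_set2|ne] := eqVneq [set y; z] [set v; c].
    by case=> -[_ ->]; rewrite ?component_del_refl ?eqxx ?orbT.
  by rewrite (component_del_step yc ayz ne) orbT.
move=> y z /or3P[/eqP-> | ya | yb] /andP[ayz ne].
- have := hN _ ayz; rewrite !inE => /or3P[] /eqP e; subst z.
  + by rewrite setUC eqxx in ne.
  + by rewrite connect0 orbT.
  + by rewrite connect0 !orbT.
- by case/orP: (step _ _ _ ayz ya) => ->; rewrite ?orbT.
- by case/orP: (step _ _ _ ayz yb) => ->; rewrite ?orbT.
Qed.

End TreeCuts.

Section BalancedCut.
Variables (V : finType) (D : rank_decomposition V).
Local Notation T := (rd_tree D).
Local Notation side := (@rd_side V D).
Let treeT := rd_is_tree D.

Lemma rd_sideC u v : adj T u v -> side u v v = ~: side u v u.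
Proof.
move=> auv; apply/setP => x; rewrite !inE -!(in_set (connect _ _)).
have := component_del_cover treeT (rd_leaf D x) auv.
have := @component_del_disj _ _ treeT u v (rd_leaf D x) auv.
rewrite !inE; do 2!case: connect => //=; by move=> /(_ isT isT).
Qed.

Lemma rd_leafP x : degree T (rd_leaf D x) = 1.
Proof.
apply/eqP; have : rd_leaf D x \in leaves T by rewrite -rd_leaf_onto imset_f.
by rewrite inE.
Qed.

Variable X : {set V}.
Hypothesis X2 : 1 < #|X|.
Local Notation wt u v := #|side u v v :&: X|.

Lemma wt_sum u v : adj T u v -> wt u v + wt v u = #|X|.
Proof.
move=> auv; rewrite rd_sideC // /rd_side (component_delC _ v u u).
by rewrite -/(side u v u) -(cardsID (side u v u) X) setDE addnC; congr (_ + _); rewrite setIC.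
Qed.

(** The two branches at [v] away from [u] share the weight beyond [v], so the heavier one has more
    than a third of [X]. *)
Lemma wt_step u v : adj T u v -> 2 * #|X| < 3 * wt u v ->
  exists a, [/\ adj T v a, #|X| < 3 * wt v a &
     component_del T v a a \proper component_del T u v v].
Proof.
move=> auv h; have avu : adj T v u by rewrite adj_sym.
case: (@rd_subcubic _ D v) => dv.
  (* A leaf carries at most one vertex, while the weight beyond [v] is at least 2, as it exceeds two
     thirds of [#|X| >= 2]. *)
  have : wt u v <= 1; last by lia.
  apply: leq_trans (subset_leq_card (subsetIl _ _)) _.
  have nbv c : adj T v c -> c = u.
    move: dv => /eqP/cards1P[w E] avc.
    have: c \in [set w] by rewrite -E inE.
    have: u \in [set w] by rewrite -E inE.
    by rewrite !inE => /eqP-> /eqP->.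
  have sub x : x \in side u v v -> rd_leaf D x = v.
    rewrite !inE => cx.
    apply: (connect_invariant (P := fun x => x = v) _ _ cx) => // a b -> /andP[avb].
    by rewrite (nbv _ avb) setUC eqxx.
  apply/card_le1_eqP => x y /sub ex /sub ey; apply: (@rd_leaf_inj _ D).
  by rewrite ex ey.
have /cards2P[a [b [neab E]]] : #|[set y | adj T v y] :\ u| == 2.
  by have := cardsD1 u [set y | adj T v y]; rewrite -/(degree T v) dv inE avu => /eqP; rewrite eqSS eq_sym.
have /[!inE]/andP[neau ava] : a \in [set y | adj T v y] :\ u by rewrite E set21.
have /[!inE]/andP[nebu avb] : b \in [set y | adj T v y] :\ u by rewrite E set22.
have hN c : adj T v c -> c \in [:: u; a; b].
  move=> avc; rewrite !inE; have [//|necu] := eqVneq c u.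
  have : c \in [set y | adj T v y] :\ u by rewrite !inE necu avc.
  by rewrite E !inE.
have le : wt u v <= wt v a + wt v b.
  apply: leq_trans (leq_card_setU _ _).
  apply: subset_leq_card; apply/subsetP => x /[!inE] /andP[xs ->]; rewrite !andbT.
  have := @component_del_branch _ T u v a b (rd_leaf D x) auv ava avb hN.
  rewrite !inE => /(_ xs)/orP[/eqP e|//].
  by have := rd_leafP x; rewrite e dv.
have [ha|hb] : #|X| < 3 * wt v a \/ #|X| < 3 * wt v b by lia.
  by exists a; split => //; apply: component_del_sub.
by exists b; split => //; apply: component_del_sub.
Qed.

(** Start at the edge of a leaf and walk on into branches with more than a third of [X]. The
    component ahead shrinks, so at some edge the weight behind reaches a third as well. *)
Lemma balanced_edge : exists u v, [/\ adj T u v, #|X| <= 3 * wt u v & #|X| <= 3 * wt v u].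
Proof.
suff H m u v : adj T u v -> #|component_del T u v v| <= m -> #|X| <= 3 * wt u v ->
    exists u v, [/\ adj T u v, #|X| <= 3 * wt u v & #|X| <= 3 * wt v u].
  have [x _] : exists x, x \in X by apply/set0Pn; rewrite -card_gt0; lia.
  have /eqP/cards1P[v E] := rd_leafP x.
  have auv : adj T (rd_leaf D x) v by have := set11 v; rewrite -E inE.
  have avu : adj T v (rd_leaf D x) by rewrite adj_sym.
  have [h|h] : #|X| <= 3 * wt (rd_leaf D x) v \/ #|X| <= 3 * wt v (rd_leaf D x).
  - by have := wt_sum auv; lia.
  - exact: H auv (leqnn _) h.
  - exact: H avu (leqnn _) h.
elim: m u v => [|m IH] u v auv.
  rewrite leqn0 cards_eq0 => /eqP E _.
  by have := component_del_refl T u v v; rewrite E inE.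
move=> cm h; have [h2|h2] := leqP #|X| (3 * wt v u); first by exists u, v.
have hh : 2 * #|X| < 3 * wt u v by have := wt_sum auv; lia.
have [a [ava ha /proper_card pa]] := wt_step auv hh.
by apply: IH ava _ (ltnW ha); lia.
Qed.

End BalancedCut.

(** [D0] shows that the minimum in [rank_width] is over a nonempty set, so it is attained. *)
Lemma rank_width_width (V : finType) (G : sgraph V) (D0 : rank_decomposition V) :
  1 < #|V| -> exists D : rank_decomposition V, rd_width G D = rank_width G.
Proof.
move=> V2; rewrite /rank_width leqNgt V2 /=.
case: pselect => [ex|[]]; last by exists (rd_width G D0); apply/asboolP; exists D0.
by case: ex_minnP => m /asboolP[D <-] _; exists D.
Qed.

Lemma rank_width_le (V : finType) (G : sgraph V) (D : rank_decomposition V) k :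
  rd_width G D <= k -> rank_width G <= k.
Proof.
rewrite /rank_width; case: ifP => // _ h; case: pselect => // ex.
by case: ex_minnP => m _ /(_ (rd_width G D)) H; apply: leq_trans h; apply: H; apply/asboolP; exists D.
Qed.

Lemma balanced_cut (V : finType) (G : sgraph V) (D0 : rank_decomposition V) (X : {set V}) :
  1 < #|X| -> exists A : {set V},
    [/\ #|X| <= 3 * #|A :&: X|, #|X| <= 3 * #|~: A :&: X| & cutrank G A (~: A) <= rank_width G].
Proof.
move=> X2; have V2 : 1 < #|V| by apply: leq_trans X2 (max_card _).
have [D <-] := rank_width_width G D0 V2.
have [u [v [auv h1 h2]]] := balanced_edge D X2.
exists (rd_side u v u); rewrite -(rd_sideC auv); split.
- by rewrite /rd_side component_delC; exact: h2.
- exact: h1.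
exact: (@leq_bigmax_cond _ _ (fun e : rd_node D * rd_node D => cutrank G (rd_side e.1 e.2 e.1) (rd_side e.1 e.2 e.2)) (u, v)).
Qed.

(** * Building rank-decompositions *)

Section ParentTree.
Variables (N : finType) (rt : N) (pa : N -> N) (h : N -> nat).
Hypothesis h_pa : forall x, x != rt -> h (pa x) < h x.

(** A rooted tree is encoded by the parent map [pa], whose value at the root [rt] is ignored; the
    height [h], smaller at parents, makes climbing end at the root. *)
Definition parent_edges : {set {set N}} := [set [set x; pa x] | x in [set~ rt]].

Lemma parent_edges_card2 : [forall e in parent_edges, #|e| == 2].
Proof.
apply/forall_inP => e /imsetP[x /[!inE] xr ->]; rewrite cards2.
by have := h_pa xr; have [ex|//] := eqVneq x (pa x); rewrite -ex ltnn.
Qed.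

Definition parent_graph : sgraph N := exist _ parent_edges parent_edges_card2.

Lemma parent_adjP x y : reflect (x != rt /\ y = pa x \/ y != rt /\ x = pa y) (adj parent_graph x y).
Proof.
apply: (iffP imsetP) => [[z /[!inE] zr /eq_set2[][-> ->]]|]; [by left|by right|].
case=> -[nr ->]; first by exists x; rewrite ?inE.
by exists y; rewrite ?inE // setUC.
Qed.

Lemma parent_adj x : x != rt -> adj parent_graph x (pa x).
Proof. by move=> xr; apply/parent_adjP; left. Qed.

(** Climbing from the first argument reaches the second, so the first lies in the subtree below the
    second. *)
Definition descends : rel N := connect [rel a b | (a != rt) && (b == pa a)].

Lemma descendsE x y : descends x y = (x == y) || (x != rt) && descends (pa x) y.
Proof.
apply/idP/orP => [/connectP[p]|].
  case: p => [_ /= ->|a p /= /andP[/andP[xr /eqP->] pp] ->]; first by left.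
  by right; rewrite xr; apply/connectP; exists p.
case=> [/eqP->|/andP[xr d]]; first exact: connect0.
by apply: connect_trans d; apply: connect1; rewrite /= xr eqxx.
Qed.

Lemma descends_root x : descends x rt.
Proof.
have [m] := ubnP (h x); elim: m x => // m IH x; rewrite ltnS => hx.
rewrite descendsE; have [//|xr /=] := eqVneq x rt.
by apply: IH; apply: leq_trans (h_pa xr) hx.
Qed.

(** A vertex of largest [h] on a cycle can only have its parent as a neighbour there, so its two
    neighbours on the cycle coincide. *)
Lemma parent_tree : is_tree parent_graph.
Proof.
split=> [|x y|c]; first by apply/card_gt0P; exists rt.
  have con z : connect (adj parent_graph) z rt.
    apply: (connect_invariant (P := fun a => connect (adj parent_graph) z a) _ _ (descends_root z)).
      exact: connect0.
    move=> a b za /andP[ar /eqP->]; apply: connect_trans za (connect1 _).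
    exact: parent_adj.
  apply: connect_trans (con x) _.
  by rewrite sym_connect_sym //; apply: adj_sym.
move=> /andP[cc uc]; rewrite ltnNge; apply/negP => c3.
have [x0 x0c] : exists x, x \in c by case: c c3 {cc uc} => // x c _; exists x; rewrite mem_head.
pose x := [arg max_(i > x0 in c) h i].
have [xc xmax] : x \in c /\ forall y, y \in c -> h y <= h x.
  by rewrite /x; case: arg_maxnP.
have [i c' ec] := rot_to xc.
have cyc' : cycle (adj parent_graph) (x :: c') by rewrite -ec rot_cycle.
have uc' : uniq (x :: c') by rewrite -ec rot_uniq.
have sz : size (x :: c') = size c by rewrite -ec size_rot.
have mc' z : z \in x :: c' -> h z <= h x by rewrite -ec mem_rot; apply: xmax.
have key z : z \in x :: c' -> adj parent_graph x z -> z = pa x.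
  move=> zc /parent_adjP[][nr //] ex.
  by have := mc' _ zc; rewrite {1}ex leqNgt h_pa.
rewrite -sz in c3.
case: c' c3 ec cyc' uc' {sz mc'} key => [|y [|z c']] // _ _ cyc' uc' key.
have y1 : y = pa x.
  apply: key; first by rewrite !inE eqxx orbT.
  by case/andP: cyc'.
have z1 : last z c' = pa x.
  apply: key; first by rewrite inE; apply/orP; right; rewrite inE mem_last orbT.
  by move: cyc'; rewrite /= rcons_path => /and4P[_ _ _]; rewrite adj_sym.
move: uc'; rewrite /= => /and3P[_ /negP[]].
by rewrite y1 -z1 mem_last.
Qed.

Definition children x := [set y | (y != rt) && (pa y == x)].

Lemma parent_degree x : degree parent_graph x = #|children x| + (x != rt).
Proof.
rewrite /degree; have [->|xr] := eqVneq x rt.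
  rewrite addn0; apply: eq_card => y; rewrite !inE.
  apply/parent_adjP/andP => [[][]|[yr /eqP e]]; rewrite ?eqxx //.
    by move=> yr e; rewrite yr -e eqxx.
  by right; rewrite yr e.
have -> : [set y | adj parent_graph x y] = pa x |: children x.
  apply/setP => y; rewrite !inE; apply/parent_adjP/orP.
    by move=> [][nr ->]; [left|right; rewrite nr eqxx].
  by case=> [/eqP->|/andP[yr /eqP <-]]; [left|right].
rewrite cardsU1 inE addnC; congr (_ + _); apply/eqP; rewrite eqb1 negb_and negbK.
have [//|pr /=] := eqVneq (pa x) rt; apply/eqP => e.
by have := h_pa xr; have := h_pa pr; rewrite e; lia.
Qed.

Lemma parent_side x y : x != rt -> (y \in component_del parent_graph x (pa x) x) = descends y x.
Proof.
move=> xr; apply/idP/idP.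
  rewrite inE => cy; apply: (connect_invariant (P := fun y => descends y x) _ _ cy); first exact: connect0.
  move=> a b da /= /andP[/parent_adjP[][nr e] ne].
    move: da; rewrite descendsE nr -e => /orP[/eqP ax|//].
    by rewrite e ax eqxx in ne.
  by rewrite descendsE nr -e da orbT.
have [m] := ubnP (h y); elim: m y => // m IH y; rewrite ltnS => hy.
rewrite descendsE => /orP[/eqP->|]; first exact: component_del_refl.
move=> /andP[yr dx]; have [->|neyx] := eqVneq y x; first exact: component_del_refl.
apply: component_del_step (IH _ (leq_trans (h_pa yr) hy) dx) _ _.
  by rewrite adj_sym parent_adj.
apply/eqP => /eq_set2[][e1 e2]; last by rewrite e2 eqxx in neyx.
by have := h_pa xr; have := h_pa yr; rewrite e1 -e2; lia.
Qed.

End ParentTree.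

(** * Hierarchies of vertex sets and the trees they describe *)

Section Hierarchies.
Variable V : finType.

(** A rooted binary tree, recorded by the sets of vertices at the leaves below its nodes; [Q] holds
    for all of these sets. *)
Inductive hier (Q : {set V} -> Prop) : {set V} -> Prop :=
| hier1 v : Q [set v] -> hier Q [set v]
| hierU X Y : hier Q X -> hier Q Y -> [disjoint X & Y] -> Q (X :|: Y) -> hier Q (X :|: Y).

Lemma hierQ Q X : hier Q X -> Q X.
Proof. by case. Qed.

Lemma hier_mono (Q Q' : {set V} -> Prop) (X : {set V}) :
  (forall Y : {set V}, Y \subset X -> Q Y -> Q' Y) -> hier Q X -> hier Q' X.
Proof.
move=> sQ hX; elim: hX sQ => [v Qv|A B _ IA _ IB dAB QAB] sQ.
  by apply: hier1; apply: sQ.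
apply: hierU => //; last exact: sQ.
  by apply: IA => Y sY; apply: sQ; apply: subset_trans sY (subsetUl _ _).
by apply: IB => Y sY; apply: sQ; apply: subset_trans sY (subsetUr _ _).
Qed.

(* The set [L x] consists of the vertices placed at the leaves below [x]. *)
Definition realizes (Q : {set V} -> Prop) (X : {set V}) (N : finType) (r : N)
    (pa : N -> N) (h : N -> nat) (L : N -> {set V}) :=
  [/\ forall x, x != r -> h (pa x) < h x,
      L r = X,
      forall x, Q (L x)
    & forall x, (children r pa x = set0 /\ #|L x| = 1) \/
        exists y z, [/\ y != z, children r pa x = [set y; z], L x = L y :|: L z & [disjoint L y & L z]]].

(** A union is realized by hanging the trees of both parts below a new root [None]. *)
Lemma hier_realizes Q X : hier Q X -> exists N r pa h L, @realizes Q X N r pa h L.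
Proof.
elim=> [v Qv|A B hA [N1 [r1 [p1 [h1 [L1 [m1 e1 q1 c1]]]]]] hB [N2 [r2 [p2 [h2 [L2 [m2 e2 q2 c2]]]]]] dAB QAB].
  exists unit, tt, id, (fun=> 0), (fun=> [set v]); split=> [[]||?|[]] //.
  left; split; last by rewrite cards1.
  by apply/setP => -[]; rewrite !inE.
pose N := option (N1 + N2)%type.
pose pa (x : N) : N := match x with
  | Some (inl x) => if x == r1 then None else Some (inl (p1 x))
  | Some (inr x) => if x == r2 then None else Some (inr (p2 x))
  | None => None end.
pose h (x : N) := match x with Some (inl x) => (h1 x).+1 | Some (inr x) => (h2 x).+1 | None => 0 end.
pose L (x : N) := match x with Some (inl x) => L1 x | Some (inr x) => L2 x | None => A :|: B end.
exists N, None, pa, h, L; split => //.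
- move=> [[x|x]|] //= _.
    by case: eqVneq => //= xr; rewrite ltnS m1.
  by case: eqVneq => //= xr; rewrite ltnS m2.
- by move=> [[x|x]|] /=.
move=> [[x|x]|] /=.
- have E : children None pa (Some (inl x)) = [set Some (inl y) | y in children r1 p1 x].
    apply/setP => -[[y|y]|]; rewrite !inE /=.
    + apply/idP/imsetP => [|[z /[!inE]/andP[zr /eqP <-] [->]]].
        by case: ifPn => [_ /eqP|yr /eqP[e]] //; exists y; rewrite // inE yr e eqxx.
      by rewrite (negPf zr).
    + have -> : (if y == r2 then None else Some (inr (p2 y))) == Some (inl x) :> N = false by case: ifP.
      by symmetry; apply/imsetP => -[].
    + by symmetry; apply/imsetP => -[].
  rewrite E; case: (c1 x) => [[-> ->]|[y [z [yz -> -> d]]]]; first by left; rewrite imset0.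
  by right; exists (Some (inl y)), (Some (inl z)); rewrite imsetU1 imset_set1.
- have E : children None pa (Some (inr x)) = [set Some (inr y) | y in children r2 p2 x].
    apply/setP => -[[y|y]|]; rewrite !inE /=.
    + have -> : (if y == r1 then None else Some (inl (p1 y))) == Some (inr x) :> N = false by case: ifP.
      by symmetry; apply/imsetP => -[].
    + apply/idP/imsetP => [|[z /[!inE]/andP[zr /eqP <-] [->]]].
        by case: ifPn => [_ /eqP|yr /eqP[e]] //; exists y; rewrite // inE yr e eqxx.
      by rewrite (negPf zr).
    + by symmetry; apply/imsetP => -[].
  rewrite E; case: (c2 x) => [[-> ->]|[y [z [yz -> -> d]]]]; first by left; rewrite imset0.
  by right; exists (Some (inr y)), (Some (inr z)); rewrite imsetU1 imset_set1.
- right; exists (Some (inl r1)), (Some (inr r2)); split => //=; last by rewrite e1 e2.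
    apply/setP => -[[y|y]|]; rewrite !inE //=.
      by rewrite orbF; case: (eqVneq y r1) => [->|yr]; rewrite ?eqxx //; symmetry; apply/eqP => -[] /eqP; rewrite (negPf yr).
    by case: (eqVneq y r2) => [->|yr]; rewrite ?eqxx //; symmetry; apply/eqP => -[] /eqP; rewrite (negPf yr).
  by rewrite e1 e2.
Qed.

Section Decomposition.
Variables (Q : {set V} -> Prop) (v0 : V) (N : finType) (r : N) (pa0 : N -> N) (h0 : N -> nat) (L0 : N -> {set V}).
Hypothesis real : realizes Q (~: [set v0]) r pa0 h0 L0.

(* The extra root [None] is the leaf of [v0]; its only child is [Some r]. *)
Let pa (x : option N) : option N :=
  if x is Some y then if y == r then None else Some (pa0 y) else None.
Let h (x : option N) := if x is Some y then (h0 y).+1 else 0.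
Let L (x : option N) : {set V} := if x is Some y then L0 y else setT.
Let ch := children None pa.
Let desc := descends None pa.

Let h_pa x : x != None -> h (pa x) < h x.
Proof.
case: x => //= y _; case: real => m _ _ _; case: ifPn => //= yr.
by rewrite ltnS m.
Qed.

Let ch_root : ch None = [set Some r].
Proof.
apply/setP => -[y|]; rewrite !inE //=; case: (eqVneq y r) => [->|yr]; rewrite ?eqxx //.
by symmetry; apply/eqP => -[] /eqP; rewrite (negPf yr).
Qed.

Let ch_Some x : ch (Some x) = [set Some y | y in children r pa0 x].
Proof.
apply/setP => -[y|]; rewrite !inE /=; last by symmetry; apply/imsetP => -[].
apply/idP/imsetP => [|[z /[!inE]/andP[zr /eqP <-] [->]]].
  by case: ifPn => [_ /eqP|yr /eqP[e]] //; exists y; rewrite // inE yr e eqxx.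
by rewrite (negPf zr).
Qed.

Let L_ch x : x != None -> (ch x = set0 /\ #|L x| = 1) \/
  exists y z, [/\ y != z, ch x = [set y; z], L x = L y :|: L z & [disjoint L y & L z]].
Proof.
case: x => // x _; rewrite ch_Some; case: real => _ _ _ c.
case: (c x) => [[-> ?]|[y [z [yz -> e d]]]]; first by left; rewrite imset0.
by right; exists (Some y), (Some z); rewrite imsetU1 imset_set1.
Qed.

Let L_pa x : x != None -> L x \subset L (pa x).
Proof.
move=> xr; have [->|pr] := eqVneq (pa x) None; first exact: subsetT.
have xc : x \in ch (pa x) by rewrite inE xr eqxx.
case: (L_ch pr) => [[e _]|[y [z [_ e -> _]]]]; first by rewrite e inE in xc.
by move: xc; rewrite e !inE => /orP[]/eqP->; rewrite ?subsetUl ?subsetUr.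
Qed.

Let desc_L x y : desc x y -> L x \subset L y.
Proof.
have [m] := ubnP (h x); elim: m x => // m IH x; rewrite ltnS => hx.
rewrite /desc descendsE => /orP[/eqP->//|/andP[xr d]].
apply: subset_trans (L_pa xr) _; apply: IH d.
exact: leq_trans (h_pa xr) hx.
Qed.

Let desc_ch x y : desc x y -> x = y \/ exists2 c, c \in ch y & desc x c.
Proof.
have [m] := ubnP (h x); elim: m x => // m IH x; rewrite ltnS => hx.
rewrite /desc descendsE => /orP[/eqP->|/andP[xr d]]; first by left.
case: (IH _ (leq_trans (h_pa xr) hx) d) => [e|[c cy dc]]; right.
  by exists x; rewrite ?inE ?xr ?e ?eqxx //; apply: connect0.
by exists c => //; rewrite /desc descendsE; apply/orP; right; rewrite xr; exact: dc.
Qed.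

(** The descent from [x] always enters a child whose set contains [v]; it ends because [h] grows and
    is bounded. *)
Let leaf_below v x : x != None -> v \in L x ->
  exists y, [/\ y != None, ch y = set0, v \in L y & desc y x].
Proof.
have hM y : h y <= \max_z h z by apply: leq_bigmax.
have [m] := ubnP (\max_z h z - h x); elim: m x => // m IH x; rewrite ltnS => hx xr vx.
case: (L_ch xr) => [[c0 _]|[y [z [_ e eL _]]]].
  by exists x; split => //; apply: connect0.
have [c cx vc] : exists2 c, c \in ch x & v \in L c.
  by move: vx; rewrite eL inE => /orP[] vc; [exists y|exists z]; rewrite // e !inE eqxx ?orbT.
move: (cx); rewrite inE => /andP[cr /eqP pc].
have hc := h_pa cr; rewrite pc in hc.
have [|w [wr cw vw dw]] := IH c _ cr vc; first by have := hM c; lia.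
exists w; split => //; apply: connect_trans dw (connect1 _).
by rewrite /= cr pc eqxx.
Qed.

(** By induction [y] lies below the parent of [x]. As siblings have disjoint sets, the child through
    which it does so is [x]. *)
Let leaf_desc v x y : y != None -> ch y = set0 -> v \in L y -> x != None -> v \in L x -> desc y x.
Proof.
move=> yr cy vy; have [m] := ubnP (h x); elim: m x => // m IH x; rewrite ltnS => hx xr vx.
have xc : x \in ch (pa x) by rewrite inE xr eqxx.
have [pr|pr] := eqVneq (pa x) None.
  case: (desc_ch (descends_root h_pa y)) => [e|[c]]; first by rewrite e eqxx in yr.
  by rewrite ch_root inE => /eqP->; rewrite pr ch_root inE in xc; rewrite (eqP xc).
have vp := subsetP (L_pa xr) v vx.
have dp := IH _ (leq_trans (h_pa xr) hx) pr vp.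
case: (desc_ch dp) => [e|[c cc dc]]; first by rewrite -e cy inE in xc.
have vc := subsetP (desc_L dc) v vy.
case: (L_ch pr) => [[e _]|[y' [z' [_ e _ dis]]]]; first by rewrite e inE in xc.
have nb a b : [disjoint L a & L b] -> v \in L a -> v \in L b -> False.
  by move=> d va vb; have /pred0P/(_ v) := d; rewrite /= va vb.
move: cc xc; rewrite e !inE => /orP[]/eqP ec /orP[]/eqP ex; subst => //.
  by case: (nb _ _ dis).
by case: (nb _ _ dis).
Qed.

Let lf v : option N := if v == v0 then None
  else odflt None [pick y | [&& y != None, ch y == set0 & v \in L y]].

Let L_r v : v != v0 -> v \in L (Some r).
Proof. by case: real => _ e _ _ vv; rewrite /= e !inE. Qed.

Let lfP v : v != v0 -> [/\ lf v != None, ch (lf v) = set0 & v \in L (lf v)].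
Proof.
move=> vv; rewrite /lf (negPf vv).
case: pickP => [y /and3P[yr /eqP]|no] //.
have [//|y [yr cy vy _]] := @leaf_below v (Some r) _ (L_r vv).
by have := no y; rewrite yr cy vy eqxx.
Qed.

Let lf_uniq v y : v != v0 -> y != None -> ch y = set0 -> v \in L y -> lf v = y.
Proof.
move=> vv yr cy vy; have [lr cl vl] := lfP vv.
by case: (desc_ch (leaf_desc lr cl vl yr vy)) => // -[c]; rewrite cy inE.
Qed.

Let lf_desc v x : x != None -> desc (lf v) x = (v \in L x).
Proof.
move=> xr; have [->|vv] := eqVneq v v0.
  rewrite /lf eqxx /desc descendsE /= orbF eq_sym (negPf xr); symmetry.
  have dx : desc x (Some r).
    case: (desc_ch (descends_root h_pa x)) => [e|[c]]; first by rewrite e eqxx in xr.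
    by rewrite ch_root inE => /eqP->.
  apply/negP => /(subsetP (desc_L dx)) /=.
  by case: real => _ -> _ _; rewrite !inE eqxx.
have [lr cl vl] := lfP vv.
apply/idP/idP; last exact: leaf_desc.
by move=> /desc_L/subsetP; apply.
Qed.

Let T := parent_graph h_pa.

Let T_subcubic : subcubic T.
Proof.
move=> x; rewrite parent_degree -/ch; have [->|xr] := eqVneq x None.
  by left; rewrite ch_root cards1.
case: (L_ch xr) => [[-> _]|[y [z [yz -> _ _]]]]; first by left; rewrite cards0.
by right; rewrite cards2 yz.
Qed.

Let lf_inj : injective lf.
Proof.
move=> v w e; have [ev|vv] := eqVneq v v0; have [ew|ww] := eqVneq w v0.
- by rewrite ev ew.
- by have [] := lfP ww; rewrite -e /lf ev eqxx.
- by have [] := lfP vv; rewrite e /lf ew eqxx.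
have [lr cl vl] := lfP vv; have [_ _ wl] := lfP ww; rewrite -e in wl.
case: (L_ch lr) => [[_ /eqP/cards1P[u eu]]|[y [z [_ ez _ _]]]].
  by move: vl wl; rewrite eu !inE => /eqP-> /eqP->.
by have := set21 y z; rewrite -ez cl inE.
Qed.

Let lf_onto : [set lf x | x : V] = leaves T.
Proof.
apply/setP => x; rewrite inE parent_degree -/ch.
have [->|xr] := eqVneq x None.
  rewrite ch_root cards1 eqxx; apply/imsetP; exists v0 => //.
  by rewrite /lf eqxx.
rewrite addn1 eqSS cards_eq0; apply/imsetP/eqP => [[v _ ev]|cx].
  have [e|vv] := eqVneq v v0; first by rewrite ev /lf e eqxx in xr.
  by rewrite ev; have [] := lfP vv.
case: (L_ch xr) => [[_ /eqP/cards1P[v ev]]|[y [z [_ ez _ _]]]]; last first.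
  by have := set21 y z; rewrite -ez cx inE.
have vx : v \in L x by rewrite ev inE.
have vv : v != v0.
  by apply: contraTneq vx => ->; rewrite -lf_desc // /lf eqxx /desc descendsE /= orbF eq_sym.
by exists v => //; rewrite (lf_uniq vv xr cx vx).
Qed.

Definition hier_rd := RankDecomposition (parent_tree h_pa) T_subcubic lf_inj lf_onto.

Lemma hier_rd_side (u v : rd_node hier_rd) : adj (rd_tree hier_rd) u v ->
  exists2 X, Q X & rd_side u v u = X /\ rd_side u v v = ~: X \/ rd_side u v u = ~: X /\ rd_side u v v = X.
Proof.
have QL x : x != None -> Q (L x) by case: x => // x _; case: real => _ _ q _; apply: q.
have side x : x != None -> @rd_side _ hier_rd x (pa x) x = L x.
  by move=> xr; apply/setP => w; rewrite inE parent_side //; exact: lf_desc.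
have sideC x : x != None -> @rd_side _ hier_rd x (pa x) (pa x) = ~: L x.
  move=> xr; rewrite rd_sideC ?side //; exact: parent_adj.
move=> /parent_adjP[][nr e].
  by exists (L u); [exact: QL|left; rewrite e side ?sideC].
exists (L v); [exact: QL|right].
by rewrite /rd_side !(component_delC _ u v) e -!/(rd_side _ _ _) sideC ?side.
Qed.

End Decomposition.

(** Tree edges occur in both directions in [rd_width], hence the bounds for both orders of a cut.
    The vertex [v0] becomes the leaf at the root. *)
Lemma hier_rank_width (G : sgraph V) (k : nat) (v0 : V) :
  hier (fun X => cutrank G X (~: X) <= k /\ cutrank G (~: X) X <= k) (~: [set v0]) ->
  exists D : rank_decomposition V, rd_width G D <= k.
Proof.
move=> /hier_realizes[N [r [pa [h [L real]]]]]; exists (hier_rd real).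
apply/bigmax_leqP => -[u v] /= /hier_rd_side[X [q1 q2]].
by case=> -[-> ->].
Qed.

(* Moving the root edge down towards a leaf [v0] replaces the pair (A U B, Y)
   by (A, B U Y), and [B U Y] is the complement of [A]. *)
Lemma hier_reroot (Q : {set V} -> Prop) X Y : (forall X, Q X -> Q (~: X)) ->
  hier Q X -> hier Q Y -> ~: X = Y -> exists v0, hier Q (~: [set v0]).
Proof.
move=> QC hX; elim: hX Y => [v _ Y hY e|A B hA IA hB IB dAB QAB Y hY e]; first by exists v; rewrite e.
have eA : ~: A = B :|: Y.
  rewrite -e; apply/setP => x; rewrite !inE.
  have /pred0P/(_ x) /= := dAB; by do 2!case: (x \in _).
apply: (IA (B :|: Y)) => //; apply: hierU => //; last by rewrite -eA; apply: QC; apply: hierQ hA.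
by rewrite -e -setI_eq0; apply/eqP/setP => x; rewrite !inE; do 2!case: (x \in _).
Qed.
End Hierarchies.

(** * Cuts of small rank *)

Lemma exists_subset_card (V : finType) (A : {set V}) m :
  m <= #|A| -> exists2 B : {set V}, B \subset A & #|B| = m.
Proof.
move=> mA; exists [set x in take m (enum A)].
  by apply/subsetP => x; rewrite inE => /mem_take; rewrite mem_enum.
rewrite cardsE (card_uniqP _) ?take_uniq ?enum_uniq // size_takel //.
by rewrite -cardE.
Qed.

Section Deterministic.
Variables (V : finType) (G : sgraph V).
Implicit Types (A B I J S W X : {set V}).

(** Splitting off one vertex at a time yields a caterpillar. *)
Lemma hier_small (Q : {set V} -> Prop) m X :
  (forall Y : {set V}, #|Y| <= m -> Q Y) -> X != set0 -> #|X| <= m -> hier Q X.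
Proof.
move=> QY; have [k] := ubnP #|X|; elim: k X => // k IH X.
rewrite ltnS => Xk X0 Xm; have [v vX] := set0Pn _ X0.
have [X1|X1] := eqVneq (X :\ v) set0.
  by rewrite -(setD1K vX) X1 setU0; apply: hier1; apply: QY; rewrite cards1; have := cardsD1 v X; rewrite vX; lia.
have cX := cardsD1 v X; rewrite vX in cX.
rewrite -(setD1K vX); apply: hierU.
- by apply: hier1; apply: QY; rewrite cards1; lia.
- by apply: IH => //; lia.
- by rewrite disjoints_subset; apply/subsetP => x /[!inE] /eqP->; rewrite eqxx.
- by apply: QY; rewrite setD1K.
Qed.

(** The parts have [m], [m] and at most [m + 2] vertices. Joining the first two and rerooting
    against the third glues the three caterpillars at one node. *)
Lemma rank_decomposition_third : 2 < #|V| ->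
  exists D : rank_decomposition V, rd_width G D <= #|V| %/ 3 + 2.
Proof.
move=> V3; set m := #|V| %/ 3.
pose Q X := cutrank G X (~: X) <= m + 2 /\ cutrank G (~: X) X <= m + 2.
have QC X : Q X -> Q (~: X) by rewrite /Q setCK => -[].
have Qs X : #|X| <= m + 2 -> Q X.
  by move=> h; split; apply: leq_trans h; [apply: cutrank_leq_left|apply: cutrank_leq_right].
have [A _ cA] : exists2 A : {set V}, A \subset [set: V] & #|A| = m.
  by apply: exists_subset_card; rewrite cardsT /m leq_div.
have cAC := cardsC A.
have [B sB cB] : exists2 B : {set V}, B \subset ~: A & #|B| = m.
  by apply: exists_subset_card; move: cAC; rewrite cA /m; lia.
have dAB : [disjoint A & B] by rewrite disjoint_sym disjoints_subset.
have cAB : #|A :|: B| = m + m.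
  by rewrite cardsU (disjoint_setI0 dAB) cards0 cA cB subn0.
have cABC := cardsC (A :|: B).
have m0 : 0 < m by rewrite /m divn_gt0.
have mV : 3 * m <= #|V| < 3 * m + 3 by rewrite /m; lia.
have hs (Y : {set V}) : 0 < #|Y| <= m + 2 -> hier Q Y.
  by case/andP=> Y0 Ym; apply: (hier_small Qs) => //; rewrite -card_gt0.
have [||v0 hv] := @hier_reroot _ Q (A :|: B) (~: (A :|: B)) QC _ _ erefl.
- apply: hierU => //; [by apply: hs; lia..|].
  (* [A :|: B] itself is large, but its complement is the small third part. *)
  by rewrite -[A :|: B]setCK; apply: QC; apply: Qs; lia.
- by apply: hs; lia.
exact: hier_rank_width hv.
Qed.

Lemma rank_width_third : 2 < #|V| -> rank_width G <= #|V| %/ 3 + 2.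
Proof. by move=> /rank_decomposition_third[D]; apply: rank_width_le. Qed.

Lemma balanced_cut_rank_width X : 2 < #|V| -> 1 < #|X| -> exists A : {set V},
  [/\ #|X| <= 3 * #|A :&: X|, #|X| <= 3 * #|~: A :&: X| & cutrank G A (~: A) <= rank_width G].
Proof. by move=> /rank_decomposition_third[D _]; apply: balanced_cut. Qed.

(** The coefficients depend on the graph and stay existential, so that a union bound over [A], [I]
    and [J] suffices. *)
Definition spanned A I J :=
  (exists c : V -> V -> 'F_2, forall a b, a \in A -> b \in ~: A ->
     (adj G a b)%:R = (\sum_(i in I) c a i * (adj G i b)%:R)%R) /\
  (exists d : V -> V -> 'F_2, forall a b, a \in A -> b \in ~: A ->
     (adj G a b)%:R = (\sum_(j in J) d b j * (adj G a j)%:R)%R).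

Lemma spanned_cut A r : cutrank G A (~: A) <= r -> exists I J,
  [/\ I \subset A, J \subset ~: A, #|I| <= r, #|J| <= r & spanned A I J].
Proof.
move=> h; have [I [c [sI lI ec]]] := cutrank_span G A (~: A).
have [J [d [sJ lJ ed]]] := cutrank_span G (~: A) A.
exists I, J; split=> //; first exact: leq_trans h.
  by apply: leq_trans h; rewrite cutrank_sym.
split; first by exists c.
exists d => a b aA bA; rewrite adj_sym ed //.
by apply: eq_bigr => j _; rewrite (adj_sym G a).
Qed.

Lemma rank_width_spanned r : 2 < #|V| -> rank_width G <= r -> exists A I J,
  [/\ #|V| <= 3 * #|A|, #|V| <= 3 * #|~: A|, I \subset A, J \subset ~: A &
   [/\ #|I| <= r, #|J| <= r & spanned A I J]].
Proof.
move=> V3 h; have [|A [h1 h2 h3]] := @balanced_cut_rank_width [set: V] V3.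
  by rewrite cardsT; lia.
rewrite !setIT cardsT in h1 h2.
have [I [J [? ? ? ? ?]]] := spanned_cut (leq_trans h3 h).
by exists A, I, J.
Qed.

(** * Edges across cuts of small rank *)

Definition touching S : {set {set V}} := [set e in val G | e :&: S != set0].
Definition crossing A : {set {set V}} := [set e in val G | (e :&: A != set0) && (e :&: ~: A != set0)].
Definition sparse s b := forall S, #|S| <= s -> #|touching S| <= b.

Lemma edgeP (e : {set V}) : e \in val G -> exists x y, [/\ e = [set x; y], x != y & adj G x y].
Proof.
move=> eG; have /forall_inP/(_ _ eG)/cards2P[x [y [xy ee]]] := valP G.
by exists x, y; rewrite /adj -ee.
Qed.

Lemma crossing_adj A (e : {set V}) : e \in crossing A ->
  exists a b, [/\ e = [set a; b], a \in A, b \in ~: A & adj G a b].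
Proof.
rewrite inE => /and3P[/edgeP[x [y [-> xy axy]]] /set0Pn[a] aA /set0Pn[b] bA].
move: aA bA; rewrite !inE => /andP[/orP[]/eqP-> h1] /andP[/orP[]/eqP-> h2]; rewrite ?h1 // in h2 *.
- by exists x, y; rewrite inE.
- by exists y, x; rewrite inE setUC adj_sym.
Qed.

(* As the columns [J] span the column space, every vertex of [A] with a
   neighbour outside [A] has one in [J]. *)
Lemma sparse_crossing A s b1 b2 : sparse s b1 -> sparse b1 b2 ->
  cutrank G A (~: A) <= s -> #|crossing A| <= b2.
Proof.
move=> sp1 sp2 /spanned_cut[I [J [_ /subsetP sJ _ lJ [_ [d ed]]]]].
pose S := [set a in A | [exists j in J, adj G a j]].
pose pA (e : {set V}) := [pick x in e :&: A].
(* Each vertex of [S] is recovered as the only end in [A] of an edge to [J], so [S] is no larger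
   than the set of edges touching [J]. *)
have cS : #|S| <= b1.
  apply: leq_trans (sp1 _ lJ); rewrite -(card_imset S (@Some_inj _)).
  apply: leq_trans (leq_imset_card pA _); apply: subset_leq_card.
  apply/subsetP => _ /imsetP[a /[!inE] /andP[aA /exists_inP[j jJ aj]] ->].
  apply/imsetP; exists [set a; j].
    by rewrite inE -/(adj G a j) aj /=; apply/set0Pn; exists j; rewrite !inE eqxx orbT.
  have := sJ _ jJ; rewrite inE => jA.
  rewrite /pA; case: pickP => [x|/(_ a)]; rewrite !inE; last by rewrite eqxx aA.
  by case/andP => /orP[]/eqP-> //; rewrite (negPf jA).
apply: leq_trans (sp2 _ cS); apply: subset_leq_card.
apply/subsetP => e eA; have [a [b [ee aA bA ab]]] := crossing_adj eA.
rewrite inE ee -/(adj G a b) ab /=; apply/set0Pn; exists a; rewrite !inE eqxx aA /=.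
apply: contraT => /exists_inPn no; have := ed _ _ aA bA; rewrite ab big1 => [/eqP|j jJ].
  by rewrite oner_eq0.
by rewrite (negPf (no _ jJ)) mulr0.
Qed.

Definition bichromatic (C : eqType) (f : V -> C) X : {set {set V}} :=
  [set e in val G | (e \subset X) && [exists x in e, [exists y in e, f x != f y]]].

(* The invariant says that at most [3 |X| / D - 1] cuts are made: each of them
   splits a piece of more than [D] vertices into two with at least [D / 3]. *)
Lemma coloring_of_cuts D b : 0 < D ->
  (forall X, D < #|X| -> exists A, [/\ #|X| <= 3 * #|A :&: X|, #|X| <= 3 * #|~: A :&: X| & #|crossing A| <= b]) ->
  forall X, D <= 3 * #|X| -> exists f : V -> seq bool,
   (forall x, x \in X -> #|[set y in X | f y == f x]| <= D) /\
   D * #|bichromatic f X| + b * D <= 3 * b * #|X|.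
Proof.
move=> D0 cuts X; have [m] := ubnP #|X|; elim: m X => // m IH X; rewrite ltnS => Xm DX.
have [XD|XD] := leqP #|X| D.
  exists (fun=> [::]); split=> [x xX|].
    by apply: leq_trans (subset_leq_card _) XD; apply/subsetP => y /[!inE]/andP[].
  have -> : bichromatic (fun _ : V => [::] : seq bool) X = set0.
    apply/setP => e; rewrite !inE; apply/negbTE; rewrite !negb_and.
    by apply/orP; right; apply/orP; right; apply/exists_inPn => x _; apply/exists_inPn => y _; rewrite eqxx.
  by rewrite cards0; nia.
have [A [h1 h2 h3]] := cuts _ XD.
have cX : #|A :&: X| + #|~: A :&: X| = #|X|.
  by rewrite -(cardsID A X) setDE ![X :&: _]setIC.
have [||f1 [c1 e1]] := IH (A :&: X); [lia..|].
have [||f2 [c2 e2]] := IH (~: A :&: X); [lia..|].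
(* The new leading bit keeps the colours of the two sides apart. *)
exists (fun x => if x \in A then true :: f1 x else false :: f2 x); split=> [x xX|].
  case: ifPn => xA.
    have xAX : x \in A :&: X by rewrite inE xA.
    apply: leq_trans (c1 _ xAX); apply: subset_leq_card.
    by apply/subsetP => y; rewrite !inE; case: ifP => // _ /andP[->].
  have xAX : x \in ~: A :&: X by rewrite !inE xA.
  apply: leq_trans (c2 _ xAX); apply: subset_leq_card.
  by apply/subsetP => y; rewrite !inE; case: ifP => // _ /andP[->].
set f := fun x => _.
have sub : bichromatic f X \subset crossing A :|: (bichromatic f1 (A :&: X) :|: bichromatic f2 (~: A :&: X)).
  apply/subsetP => e; rewrite !inE => /and3P[eG eX /exists_inP[x xe /exists_inP[y ye]]].
  rewrite eG /=; case: (eqVneq (e :&: A) set0) => [e0|eA].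
    have nA z : z \in e -> z \notin A.
      by move=> ze; apply/negP => zA; have := in_set0 z; rewrite -e0 inE ze zA.
    rewrite /f (negPf (nA _ xe)) (negPf (nA _ ye)) eqseq_cons eqxx /= => ne.
    rewrite !subsetI !eX !andbT; apply/orP; right; apply/andP; split.
      by apply/subsetP => z ze; rewrite in_setC nA.
    by apply/exists_inP; exists x => //; apply/exists_inP; exists y.
  case: (eqVneq (e :&: ~: A) set0) => //= e0 ne; apply/orP; left.
  have nA z : z \in e -> z \in A.
    by move=> ze; apply/negPn/negP => zA; have := in_set0 z; rewrite -e0 !inE ze zA.
  rewrite !subsetI !eX !andbT; apply/andP; split; first by apply/subsetP.
  apply/exists_inP; exists x => //; apply/exists_inP; exists y => //.
  by move: ne; rewrite /f !nA // eqseq_cons eqxx.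
have hc : #|bichromatic f X| <= b + (#|bichromatic f1 (A :&: X)| + #|bichromatic f2 (~: A :&: X)|).
  apply: leq_trans (subset_leq_card sub) _.
  apply: leq_trans (leq_card_setU _ _) (leq_add h3 _).
  exact: leq_card_setU.
have := leq_mul (leqnn D) hc; rewrite -cX !mulnDr; move: e1 e2; rewrite (mulnC b D).
set u := D * b; lia.
Qed.
End Deterministic.

(** * Rooted forests with few edges leaving them *)

Definition below n j : {set 'I_n} := [set i : 'I_n | i < j].
Arguments below : clear implicits.

(* [g] sends each vertex of [Z] to its parent in a spanning forest of
   [Z :|: below n j] whose roots are the vertices below [j]. *)
Definition closed_forest n (G : sgraph 'I_n) D b j (Z : {set 'I_n}) (g : 'I_n -> 'I_n) :=
  [/\ [disjoint below n j & Z], D <= #|below n j :|: Z| < 2 * D,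
      forall y, y \in Z -> g y \in below n j :|: Z /\ adj G y (g y),
      {in Z &, injective (fun y => [set y; g y])}
    & #|crossing G (below n j :|: Z)| <= b].

(** [W j] is the union of the monochromatic components meeting [below n j]. It grows by at most one
    component, hence by at most [D] vertices, at a time, so the first one with at least [D] vertices
    has fewer than [2 * D]. *)
Lemma exists_closed_forest n (G : sgraph 'I_n) (C : eqType) (f : 'I_n -> C) D b :
  0 < D <= n -> (forall x, #|[set y | f y == f x]| <= D) ->
  #|bichromatic G f setT| <= b ->
  exists j Z g, j <= n /\ closed_forest G D b j Z g.
Proof.
case/andP=> D0 Dn fD fb.
pose e := [rel x y | adj G x y && (f x == f y)].
pose W j : {set 'I_n} := [set y | [exists i in below n j, connect e i y]].
have W0 : W 0 = set0.
  apply/setP => y; rewrite !inE; apply/exists_inP => -[i].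
  by rewrite inE.
have sub j : below n j \subset W j.
  by apply/subsetP => i ij; rewrite inE; apply/exists_inP; exists i.
have Wn : W n = setT.
  by apply/setP => y; rewrite inE [RHS]inE; apply/exists_inP; exists y; rewrite ?inE.
have WS j : #|W j.+1| <= #|W j| + D.
  have [jn|nj] := ltnP j n; last first.
    suff -> : W j.+1 = W j by apply: leq_addr.
    apply/setP => y; rewrite !inE; apply: eq_existsb => i.
    by rewrite !inE (leq_trans (ltn_ord i) nj) (leq_trans (ltn_ord i) (leqW nj)).
  have cD : #|[set y | connect e (Ordinal jn) y]| <= D.
    apply: leq_trans (subset_leq_card _) (fD (Ordinal jn)).
    apply/subsetP => y; rewrite !inE => cy.
    apply: (connect_invariant (P := fun y => f y == f (Ordinal jn)) _ _ cy) => // a c /eqP <-.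
    by move=> /andP[_ /eqP->].
  apply: leq_trans (leq_add (leqnn _) cD); apply: leq_trans (leq_card_setU _ _).
  apply: subset_leq_card; apply/subsetP => y; rewrite !inE => /exists_inP[i].
  rewrite inE ltnS leq_eqVlt => /orP[/eqP ij|ij] cy; apply/orP.
    by right; have -> : Ordinal jn = i by apply: val_inj.
  by left; apply/exists_inP; exists i; rewrite ?inE.
have exj : exists j, D <= #|W j| by exists n; rewrite Wn cardsT card_ord.
have [[|j] jD jmin] := ex_minnP exj; first by rewrite W0 cards0 leqNgt D0 in jD.
have jlt : #|W j| < D by rewrite ltnNge; apply/negP => /jmin; rewrite ltnn.
have jn : j.+1 <= n by apply: jmin; rewrite Wn cardsT card_ord.
have jD2 : #|W j.+1| < 2 * D by have := WS j; lia.
move: (j.+1) jD jD2 jn => {jmin jlt}{}j jD jD2 jn.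
(* [d y] below is the distance of [y] from [below n j] along monochromatic edges; parents are chosen
   nearer to the roots. *)
pose P y m := `[< exists i p, [/\ i \in below n j, path e i p, last i p = y & size p = m] >].
have exP y : y \in W j -> exists m, P y m.
  rewrite inE => /exists_inP[i ij /connectP[p pp ey]].
  by exists (size p); apply/asboolP; exists i, p.
pose d y := if pselect (exists m, P y m) is left ex then ex_minn ex else 0.
have dP y : y \in W j -> P y (d y) /\ forall m, P y m -> d y <= m.
  by move=> /exP ex; rewrite /d; case: pselect => // ex'; case: ex_minnP.
have step y : y \in W j :\: below n j -> exists z, [/\ z \in W j, e z y & d z < d y].
  rewrite inE => /andP[yj yW]; have [/asboolP[i [p [ij pp ey sp]]] _] := dP _ yW.
  case/lastP: p pp ey sp => [|p z]; first by move=> _ /= iy; rewrite -iy ij in yj.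
  rewrite rcons_path last_rcons size_rcons => /andP[pp ez] zy sp; subst z.
  have zW : last i p \in W j.
    by rewrite inE; apply/exists_inP; exists i => //; apply/connectP; exists p.
  exists (last i p); split=> //; rewrite -sp ltnS; apply: (dP _ zW).2.
  by apply/asboolP; exists i, p.
pose g y := odflt y [pick z | [&& z \in W j, e z y & d z < d y]].
have gP y : y \in W j :\: below n j -> [/\ g y \in W j, e (g y) y & d (g y) < d y].
  move=> /step[z [z1 z2 z3]]; rewrite /g; case: pickP => [w /and3P[]//|/(_ z)].
  by rewrite z1 z2 z3.
have eW : below n j :|: (W j :\: below n j) = W j.
  by apply/setP => x; rewrite in_setU in_setD; case: (boolP (x \in below n j)) => //= xj; rewrite (subsetP (sub j)).
exists j, (W j :\: below n j), g; split=> //; rewrite /closed_forest eW; split.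
- by rewrite disjoint_sym disjoints_subset; apply/subsetP => x /[!inE] /andP[].
- by rewrite jD jD2.
- by move=> y /gP[gW /andP[gy _] _]; rewrite adj_sym.
(* Two distinct vertices with the same parent edge would be parents of each other, against the
   decrease of [d]. *)
- move=> y z /gP[_ _ dy] /gP[_ _ dz] /eq_set2[][ey ez] //.
  by move: dy dz; rewrite {1}ez -ey; lia.
(* An edge leaving [W j] joins two colours, since otherwise its outer end would belong to the same
   component. *)
apply: leq_trans fb; apply: subset_leq_card; apply/subsetP => E EW.
have [a [c [eE aW cW ac]]] := crossing_adj EW.
rewrite inE; apply/and3P; split; first by rewrite eE.
  exact: subsetT.
apply/exists_inP; exists a; first by rewrite eE set21.
apply/exists_inP; exists c; first by rewrite eE set22.
apply: contraTneq cW => fac; rewrite !inE negbK.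
move: aW; rewrite inE => /exists_inP[i ij ia]; apply/exists_inP; exists i => //.
by apply: connect_trans ia (connect1 _); rewrite /= ac fac eqxx.
Qed.

(** Rank at most [s] leaves at most [b2] edges across each balanced cut, so the pieces of
    [coloring_of_cuts] are separated by at most [3 * b2 * n / D <= b] edges. *)
Lemma closed_forest_of_sparse n (G : sgraph 'I_n) s b1 b2 b D :
  (2 < n)%N -> (0 < D <= n)%N -> (3 * b2 * n <= b * D)%N ->
  sparse G s b1 -> sparse G b1 b2 -> (rank_width G <= s)%N ->
  exists j Z g, (j <= n)%N /\ closed_forest G D b j Z g.
Proof.
move=> n2 /[dup] Dn /andP[D0 Dn'] bD sp1 sp2 rw.
have cuts (X : {set 'I_n}) : (D < #|X|)%N -> exists A : {set 'I_n},
    [/\ #|X| <= 3 * #|A :&: X|, #|X| <= 3 * #|~: A :&: X| & #|crossing G A| <= b2]%N.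
  move=> DX; have [||A [h1 h2 h3]] := @balanced_cut_rank_width _ G X; first by rewrite card_ord.
    by apply: leq_trans DX.
  exists A; split=> //; apply: (sparse_crossing sp1 sp2); exact: leq_trans h3 rw.
have [|f [fD fb]] := coloring_of_cuts D0 cuts (X := setT).
  by rewrite cardsT card_ord; lia.
rewrite cardsT card_ord in fb.
apply: (@exists_closed_forest _ _ _ f) => // [x|].
  apply: leq_trans (fD x (in_setT x)); apply: subset_leq_card.
  by apply/subsetP => y; rewrite !inE.
by rewrite -(leq_pmul2l D0) [(D * b)%N]mulnC; apply: leq_trans bD; apply: leq_trans fb; apply: leq_addr.
Qed.

Lemma leq_double_divn m n : (0 < m <= n)%N -> (n <= 2 * m * (n %/ m))%N.
Proof.
case/andP=> m0 mn; have q0 : (0 < n %/ m)%N by rewrite divn_gt0.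
have := leq_mul (leqnn m) q0; have := ltn_ceil n m0; rewrite mulnC mulnS -mulnA muln1.
by move: (m * _)%N => k; lia.
Qed.

(** As [n <= 2 * d * D], taking [b = 6 * d * b2] gives the bound required on the number of removed
    edges; the factor [M.+1] in the denominator of [b2] then keeps [M * b] at most [D]. *)
Lemma forest_parameters n d M : (1 < d)%N -> (6 * d * d * M.+1 <= n)%N ->
  let D := (n %/ d)%N in let b2 := (n %/ (6 * d * d * M.+1))%N in let b := (6 * d * b2)%N in
  [/\ (0 < D <= n)%N, (2 * D <= n)%N, (n <= 2 * d * D)%N, (M * b <= D)%N & (3 * b2 * n <= b * D)%N].
Proof.
move=> d1 nE D b2 b; have d0 : (0 < d)%N by apply: ltnW.
have E0 : (0 < 6 * d * d * M.+1)%N by rewrite !muln_gt0 d0.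
have dn : (d <= n)%N.
  apply: leq_trans nE; have -> : (6 * d * d * M.+1 = d * (6 * d * M.+1))%N by ring.
  by rewrite leq_pmulr // !muln_gt0 d0.
have nd : (n <= 2 * d * D)%N by apply: leq_double_divn; rewrite d0.
have Dd : (D * d <= n)%N by apply: leq_divM.
split=> //.
- by rewrite divn_gt0 // dn leq_div.
- by apply: leq_trans Dd; rewrite mulnC leq_mul2l d1 orbT.
- rewrite leq_divRL //; apply: leq_trans (leq_divM n (6 * d * d * M.+1)); rewrite -/b2 /b.
  have -> : (M * (6 * d * b2) * d = b2 * (6 * d * d * M))%N by ring.
  by rewrite !leq_mul2l leqnSn !orbT.
have -> : (b * D = 3 * b2 * (2 * d * D))%N by rewrite /b; ring.
by rewrite leq_mul2l nd orbT.
Qed.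

(** * Graphs of rank-width at most two *)

(* A path whose two end vertices have further neighbours on the path; such a
   path has one more edge than it has vertices. *)
Definition double_lasso (V : finType) (G : sgraph V) x p a b :=
  let s := x :: p in
  [/\ path (adj G) x p, uniq s, (1 < a < size s) && (b + 2 < size s),
      ~~ ((a == size p) && (b == 0)) & adj G x (nth x s a) && adj G (last x p) (nth x s b)].

Section Peeling.
Variables (V : finType) (G : sgraph V).
Implicit Types (S X Y : {set V}).

(** Cuts are taken in the subgraph induced by [S], so that vertices can be removed from [S] in an
    induction. *)
Let Q S X := cutrank G X (S :\: X) <= 2.

(** The leaf [w] is replaced by a node with the two leaves [v] and [w], so the old sets containing
    [w] gain [v]. *)
Lemma hier_graft (P P' : {set V} -> Prop) S v w :
  hier P S -> v \notin S -> w \in S ->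
  (forall X, X \subset S -> P X -> w \notin X -> P' X) ->
  (forall X, X \subset S -> P X -> w \in X -> P' (v |: X)) ->
  P' [set v] -> P' [set w] -> hier P' (v |: S).
Proof.
move=> hS; elim: hS => [u Pu|A B hA IA hB IB dAB PAB] vS wS h1 h2 pv pw.
  move: wS vS; rewrite !inE => /eqP ? vu; subst u.
  apply: hierU; [exact: hier1|exact: hier1| |].
    by rewrite disjoints_subset; apply/subsetP => x; rewrite !inE => /eqP->.
  by apply: h2 => //; rewrite inE.
move: vS; rewrite inE negb_or => /andP[vA vB].
have side A' B' : A' :|: B' = A :|: B -> [disjoint A' & B'] -> hier P B' ->
    (w \in A' -> hier P' (v |: A')) -> v \notin B' -> w \in A' -> hier P' (v |: (A :|: B)).
  move=> eAB dis hB' hvA' vB' wA'; rewrite -eAB setUA; apply: hierU.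
  - exact: hvA'.
  - apply: hier_mono hB' => Y sY PY; apply: h1 => //.
      by rewrite -eAB; apply: subset_trans sY (subsetUr _ _).
    apply/negP => /(subsetP sY) wB'.
    by have /pred0P/(_ w) := dis; rewrite /= wA' wB'.
  - rewrite -setI_eq0 setIUl; apply/eqP; rewrite (disjoint_setI0 dis) setU0.
    by apply/setP => x; rewrite !inE; case: eqP => // ->; rewrite (negPf vB').
  by rewrite -setUA eAB; apply: h2.
have sA : A \subset A :|: B by apply: subsetUl.
have sB : B \subset A :|: B by apply: subsetUr.
have [wA|wA] := boolP (w \in A).
  apply: (side A B) => // _; apply: IA => // X sX.
    by apply: h1; apply: subset_trans sX sA.
  by apply: h2; apply: subset_trans sX sA.
have wB : w \in B by move: wS; rewrite inE (negPf wA).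
apply: (side B A) => //; [by rewrite setUC|by rewrite disjoint_sym|].
move=> _; apply: IB => // X sX.
  by apply: h1; apply: subset_trans sX sB.
by apply: h2; apply: subset_trans sX sB.
Qed.

Definition nbrs S x := [set y in S | adj G x y].

(** The leaf [v] is grafted onto its only neighbour in [S], or onto any vertex if it has none. No
    old cut then separates [v] from a neighbour, and the new cuts split off a single vertex. *)
Lemma hier_pendant S v : v \in S -> #|nbrs S v| <= 1 ->
  (S :\ v != set0 -> hier (Q (S :\ v)) (S :\ v)) -> hier (Q S) S.
Proof.
move=> vS nv IH; have Q1 u : Q S [set u].
  by apply: leq_trans (cutrank_leq_left _ _ _) _; rewrite cards1.
have [S1|S1] := eqVneq (S :\ v) set0.
  by rewrite -{2}(setD1K vS) S1 setU0; apply: hier1.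
have [w wS wv] : exists2 w, w \in S :\ v & forall y, y \in S -> adj G v y -> y = w.
  have [n0|/set0Pn[w]] := eqVneq (nbrs S v) set0.
    have [w wS] := set0Pn _ S1; exists w => // y yS vy.
    by have := in_set0 y; rewrite -n0 inE yS vy.
  rewrite inE => /andP[wS vw]; exists w; first by rewrite !inE wS andbT eq_sym (adj_neq vw).
  by move=> y yS vy; apply: (card_le1_eqP nv); rewrite inE ?yS ?wS.
rewrite -{2}(setD1K vS); apply: (hier_graft (IH S1) _ wS) => //.
- by rewrite !inE eqxx.
- move=> X sX QX wX; apply: leq_trans QX; apply: cutrank_sub => //.
    by apply: setSD; apply: subD1set.
  move=> a b aX; rewrite !inE => /andP[bX bS] ab; rewrite aX bX bS andbT /=.
  apply: contraNneq wX => bv; rewrite -(wv a) //; last by rewrite -bv adj_sym.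
  by have := subsetP sX _ aX; rewrite !inE => /andP[].
move=> X sX QX wX; apply: leq_trans QX; apply: cutrank_sub.
- exact: subsetUr.
- by apply/subsetP => y; rewrite !inE negb_or => /and3P[-> -> ->].
move=> a b; rewrite !inE negb_or => aX /andP[/andP[bv bX] bS] ab.
rewrite bv bX bS !andbT; case/orP: aX => // /eqP av; subst a.
by rewrite (wv _ bS ab) wX in bX.
Qed.

(** No edge joins [C] to the rest of [S], so [C] adds only zero columns to the cuts of the rest. *)
Lemma hier_component S (C : {set V}) : C \subset S -> hier (Q S) C ->
  (forall x y, x \in C -> y \in S -> adj G x y -> y \in C) ->
  (S :\: C != set0 -> hier (Q (S :\: C)) (S :\: C)) -> hier (Q S) S.
Proof.
move=> sC hC clC IH; have [e|ne] := eqVneq (S :\: C) set0.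
  suff -> : S = C by move: hC; rewrite {1}(_ : S = C) //; apply/eqP; rewrite eqEsubset sC -setD_eq0 e eqxx.
  by apply/eqP; rewrite eqEsubset sC -setD_eq0 e eqxx.
have eS : C :|: (S :\: C) = S.
  by apply/setP => x; rewrite !inE; case: (boolP (x \in C)) => //= /(subsetP sC)->.
rewrite -{2}eS; apply: hierU => //.
- apply: hier_mono (IH ne) => Y sY QY; apply: leq_trans QY; apply: cutrank_sub => //.
    by apply: setSD; apply: subsetDl.
  move=> a b aY /[!inE] /andP[bY bS] ab; rewrite aY bY bS andbT /=.
  have /[!inE] /andP[aC aS] := subsetP sY _ aY.
  by apply: contraNN aC => bC; apply: (clC b); rewrite // adj_sym.
- by rewrite disjoint_sym disjoints_subset; apply/subsetP => x /[!inE] /andP[].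
by rewrite eS /Q setDv; apply: leq_trans (cutrank_leq_right _ _ _) _; rewrite cards0.
Qed.

(** * Longest paths and cycle components *)

Section LongestPath.
Hypothesis no_lasso : forall x p a b, ~ double_lasso G x p a b.
Variable S : {set V}.
Hypothesis deg2 : forall x, x \in S -> 1 < #|nbrs S x|.
Variable M : nat.
Let pathS x p := [/\ path (adj G) x p, uniq (x :: p) & {subset x :: p <= S}].
Hypothesis maxM : forall x p, pathS x p -> size p <= M.

Lemma pathS_head x p y : pathS x p -> size p = M -> y \in S -> adj G x y -> y \in p.
Proof.
case=> pp up sp sM yS xy; apply: contraT => yp.
have /maxM : pathS y (x :: p); last by rewrite /= sM ltnn.
split=> /=; first by rewrite adj_sym xy.
  by rewrite inE negb_or yp eq_sym (adj_neq xy) /=.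
by move=> z; rewrite inE => /orP[/eqP->//|/sp].
Qed.

Lemma pathS_last x p y : pathS x p -> size p = M -> y \in S -> adj G (last x p) y -> y \in x :: p.
Proof.
case=> pp up sp sM yS xy; apply: contraT => yp.
have /maxM : pathS x (rcons p y); last by rewrite size_rcons sM ltnn.
split; first by rewrite rcons_path pp.
  by rewrite -rcons_cons rcons_uniq yp.
by move=> z; rewrite -rcons_cons mem_rcons inE => /orP[/eqP->//|/sp].
Qed.

(** By the degree condition and maximality, each end of the path has a further neighbour on it. The
    two extra edges form a double lasso unless they are one and the same edge joining the ends. *)
Lemma pathS_cycle x p : pathS x p -> size p = M ->
  [/\ 1 < size p, adj G (last x p) x & forall y, y \in S -> adj G x y -> y = head x p \/ y = last x p].
Proof.
move=> ps sM; have [pp up sp] := ps.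
have two z w : z \in S -> exists y, [/\ y \in S, adj G z y & y != w].
  move=> zS; have : 0 < #|nbrs S z :\ w|.
    by have := deg2 zS; rewrite (cardsD1 w); case: (w \in _) => //=; lia.
  by case/card_gt0P => y /[!inE] /and3P[]; exists y.
have chord y : y \in S -> adj G x y -> y != head x p -> 1 < index y (x :: p) < size (x :: p).
  move=> yS xy yh; have yp := pathS_head ps sM yS xy.
  rewrite index_mem inE yp orbT andbT /= (negPf (adj_neq xy)).
  by case: (p) yp yh => // z p'; rewrite /= eq_sym => _ /negPf->.
(* The vertex at index [(size p).-1] is the predecessor of the last one; [b] is another neighbour of
   the last vertex. *)
have [b [bS lb bn]] : exists y, [/\ y \in S, adj G (last x p) y & y != nth x (x :: p) (size p).-1].
  by apply: two; apply: sp; apply: mem_last.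
have bp := pathS_last ps sM bS lb.
have bidx : index b (x :: p) + 2 < size (x :: p).
  have := bp; rewrite -index_mem /= => bs.
  have b1 : index b (x :: p) != (size p).-1 by apply: contraNneq bn => <-; rewrite nth_index.
  have b2 : index b (x :: p) != size p.
    apply/negP => /eqP e; have := nth_index x bp.
    by rewrite e nth_last /= => el; move: lb; rewrite el adj_irr.
  move: bs b1 b2; rewrite /=; set i := (if _ then _ else _); lia.
have forced y : y \in S -> adj G x y -> y != head x p -> y = last x p /\ b = x.
  move=> yS xy yh; have ys := chord _ yS xy yh.
  have yp := pathS_head ps sM yS xy.
  have ny : nth x (x :: p) (index y (x :: p)) = y by rewrite nth_index // inE yp orbT.
  have nb := nth_index x bp.
  have := @no_lasso x p (index y (x :: p)) (index b (x :: p)).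
  have [/andP[/eqP ei /eqP ej] _|ne []] := boolP ((index y (x :: p) == size p) && (index b (x :: p) == 0)).
    by split; [rewrite -ny ei nth_last|rewrite -nb ej].
  by split=> //; rewrite ?ys ?bidx // ny nb xy lb.
have [y [yS xy yh]] := two x (head x p) (sp _ (mem_head _ _)).
have [ey eb] := forced y yS xy yh.
split.
- by have /= := bidx; lia.
- by move: lb; rewrite eb.
move=> z zS xz; have [->|zh] := eqVneq z (head x p); first by left.
by right; case: (forced z zS xz zh).
Qed.

(** Rotating the cycle to start at [z] gives another longest path, to which [pathS_cycle]
    applies. *)
Lemma pathS_next_prev x p z y : pathS x p -> size p = M -> z \in x :: p -> y \in S -> adj G z y ->
  y = next (x :: p) z \/ y = prev (x :: p) z.
Proof.
move=> ps sM zp yS zy; have [pp up sp] := ps.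
have [_ cl _] := pathS_cycle ps sM.
have [i q eq] := rot_to zp.
have cyc : cycle (adj G) (z :: q) by rewrite -eq rot_cycle /= rcons_path pp.
have uq : uniq (z :: q) by rewrite -eq rot_uniq.
have sq : size q = M by apply: eq_add_S; rewrite -[LHS]/(size (z :: q)) -eq size_rot /= sM.
have pq : pathS z q.
  split=> //; first by move: cyc; rewrite /= rcons_path => /andP[].
  by move=> w; rewrite -eq mem_rot; apply: sp.
have [sz _ /(_ y yS zy)] := pathS_cycle pq sq.
rewrite -(next_rot i up) -(prev_rot i up) eq.
case: (q) uq sz => // w q' uq _ [->|->]; [left|right].
  by rewrite next_nth mem_head /= eqxx.
rewrite prev_nth mem_head.
have -> : index z (w :: q') = size (w :: q').
  by apply/eqP; rewrite eqn_leq index_size leqNgt index_mem; case/andP: uq.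
by rewrite nth_last.
Qed.

(** The tree is a caterpillar along the cycle: only the first and the last vertex of a suffix can
    have neighbours in [S] outside it. *)
Lemma hier_cycle x p : pathS x p -> size p = M -> hier (Q S) [set z in x :: p].
Proof.
move=> ps sM; have [pp up sp] := ps; set s := x :: p.
suff H m : m < size s -> hier (Q S) [set z in drop (size s - m.+1) s].
  by have := H (size p) (leqnn _); rewrite subnn drop0.
elim: m => [|m IH] ms.
  have -> : [set z in drop (size s - 1) s] = [set last x p].
    have -> : drop (size s - 1) s = [:: last x p].
      by rewrite subn1 /s [size _]/= [x :: p]lastI -cats1 drop_size_cat ?size_belast.
    by apply/setP => z; rewrite !inE.
  by apply: hier1; apply: leq_trans (cutrank_leq_left _ _ _) _; rewrite cards1.
set i := size s - m.+2; have ei : size s - m.+1 = i.+1 by rewrite /i; lia.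
have is_ : i < size s by rewrite /i; lia.
have memd z : (z \in drop i s) = (z \in s) && (i <= index z s).
  have [zs|zs] := boolP (z \in s); last by apply: contraNF zs => /mem_drop.
  rewrite leqNgt -in_take //.
  move: zs up; rewrite -/s -{1 2}(cat_take_drop i s) mem_cat cat_uniq.
  move=> /orP[zt|zd] /and3P[_ /hasPn h _]; last by rewrite zd (h _ zd).
  by rewrite zt; apply/negP => /h /=; rewrite zt.
have -> : [set z in drop i s] = [set nth x s i] :|: [set z in drop i.+1 s].
  by apply/setP => z; rewrite !inE (drop_nth x is_) inE.
apply: hierU.
- by apply: hier1; apply: leq_trans (cutrank_leq_left _ _ _) _; rewrite cards1.
- by rewrite -ei; apply: IH; apply: ltnW.
- rewrite disjoints_subset; apply/subsetP => z; rewrite !inE => /eqP->.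
  have : uniq (drop i s) by apply: drop_uniq.
  by rewrite (drop_nth x is_) /= => /andP[].
have -> : [set nth x s i] :|: [set z in drop i.+1 s] = [set z in drop i s].
  by apply/setP => z; rewrite !inE (drop_nth x is_) inE.
apply: leq_trans (_ : #|[set nth x s i; last x p]| <= 2); last by rewrite cards2; case: (_ != _).
apply: cutrank_cover => y z; rewrite !inE => yd /andP[zd zS] yz.
have /[!memd]/andP[ys iy] := yd.
apply: contraNT zd; rewrite negb_or => /andP[yi yl].
have ni : index y s != i by apply: contraNneq yi => <-; rewrite nth_index.
have nl : index y s != size p.
  by apply/negP => /eqP e; have := nth_index x ys; rewrite e nth_last /= => el; rewrite el eqxx in yl.
have lts : index y s < (size p).+1 by rewrite -[(size p).+1]/(size s) index_mem.
have h2 : (index y s).+1 < size s by rewrite [size s]/=; move: (index y s) lts nl => k; lia.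
rewrite memd; have [->|->] := pathS_next_prev ps sM ys zS yz.
  rewrite mem_next ys andTb next_nth ys.
  rewrite -[nth x p _]/(nth x s (index y s).+1) index_uniq //; exact: leqW.
rewrite mem_prev ys andTb prev_nth ys.
have yx : y != x.
  by apply/eqP => yx; have e0 : index y s = 0; [rewrite yx /s /= eqxx|lia].
have eid : index y s = (index y p).+1 by rewrite /s /= eq_sym (negPf yx).
rewrite index_uniq //; last by move: h2; rewrite eid => /ltnW/ltnW.
by move: iy ni; rewrite eid; lia.
Qed.
End LongestPath.

Lemma hier_no_lasso S : (forall x p a b, ~ double_lasso G x p a b) ->
  S != set0 -> hier (Q S) S.
Proof.
move=> nl; have [m] := ubnP #|S|; elim: m S => // m IH S; rewrite ltnS => Sm S0.
have [/exists_inP[v vS nv]|/exists_inPn big] := boolP [exists v in S, #|nbrs S v| <= 1].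
  apply: (hier_pendant vS nv); apply: IH.
  by apply: leq_trans Sm; rewrite [#|S|](cardsD1 v) vS.
have deg2 x : x \in S -> 1 < #|nbrs S x| by move=> /big; rewrite -ltnNge.
pose pathS x p := [/\ path (adj G) x p, uniq (x :: p) & {subset x :: p <= S}].
pose P m := `[< exists x p, pathS x p /\ size p = m >].
have exP : exists m, P m.
  have [x xS] := set0Pn _ S0; exists 0; apply/asboolP; exists x, [::]; split=> //.
  by split=> // z; rewrite inE => /eqP->.
have bP k : P k -> k <= #|V|.
  move=> /asboolP[x [p [[_ /andP[_ up] _] <-]]].
  by rewrite -(card_uniqP up); apply: max_card.
have [M /asboolP[x [p [ps sM]]] maxM] := ex_maxnP exP bP.
have maxM' z q : pathS z q -> size q <= M.
  by move=> zq; apply: maxM; apply/asboolP; exists z, q.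
have [pp up sp] := ps.
apply: (@hier_component S [set z in x :: p]).
- by apply/subsetP => z; rewrite inE => /sp.
- exact: (hier_cycle nl deg2 maxM' ps sM).
- move=> y z; rewrite !inE => ys zS yz; rewrite -!in_cons in ys *.
  by have [->|->] := pathS_next_prev nl deg2 maxM' ps sM ys zS yz; rewrite ?mem_next ?mem_prev.
apply: IH; apply: leq_trans Sm; apply: proper_card; apply/properP; split; first exact: subsetDl.
by exists x; [apply: sp; rewrite mem_head|rewrite !inE eqxx].
Qed.

Lemma rank_width_no_lasso : (forall x p a b, ~ double_lasso G x p a b) -> rank_width G <= 2.
Proof.
move=> nl; have [V1|V1] := leqP #|V| 1; first by rewrite /rank_width V1.
pose P X := cutrank G X (~: X) <= 2.
have PC X : P X -> P (~: X) by rewrite /P setCK cutrank_sym.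
have hT : hier P setT.
  apply: hier_mono (hier_no_lasso nl (_ : setT != set0)) => [Y _|]; first by rewrite /Q setTD.
  by rewrite -card_gt0 cardsT; lia.
(* The two sets below the root are complementary, so they describe a single edge of the final tree,
   which is moved to a leaf. *)
have [v0 hv] : exists v0, hier P (~: [set v0]).
  move: {-2}[set: V] (erefl [set: V]) hT => T eT hT; case: hT eT => [v _ e|X Y hX hY dXY _ e].
    by move: V1; rewrite -cardsT -e cards1.
  apply: (hier_reroot PC hX hY); apply/setP => z; have := in_setT z; rewrite -e !inE.
  by have /pred0P/(_ z) /= := dXY; do 2!case: (_ \in _).
have [|D] := @hier_rank_width _ G 2 v0; last exact: rank_width_le.
by apply: hier_mono hv => Y _ PY; split=> //; rewrite cutrank_sym.
Qed.
End Peeling.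

Local Open Scope ring_scope.

(** * The probability space *)

Definition slots n : {set {set 'I_n}} := [set e : {set 'I_n} | #|e| == 2%N].
Arguments slots : clear implicits.

Lemma edges_sub n (G : sgraph 'I_n) : val G \subset slots n.
Proof. by apply/subsetP => e eG; rewrite inE; have /forall_inP/(_ _ eG) := valP G. Qed.

Section Probability.
Variables (R : realType) (n : nat) (p : R).
Implicit Types (G H : sgraph 'I_n) (A B : pred (sgraph 'I_n)) (e : {set 'I_n}) (T F S : {set {set 'I_n}}).
Local Notation P := (@Gnp_prob R n p).

(** A graph is an independent choice for each pair, so the claim is distributivity. *)
Lemma sum_sgraph_prod (f : {set 'I_n} -> bool -> R) :
  \sum_(G : sgraph 'I_n) \prod_(e : {set 'I_n} | #|e| == 2%N) f e (e \in val G) = \prod_(e : {set 'I_n} | #|e| == 2%N) (f e true + f e false).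
Proof.
rewrite [RHS]big_mkcond.
(* At sets that are not pairs, the value 0 discards the families containing one, and the value 1
   makes their absence neutral. *)
rewrite (eq_bigr (fun e => (if #|e| == 2%N then f e true else 0) +
   (if #|e| == 2%N then f e false else 1))) => [|e _]; last by case: ifP; rewrite ?add0r.
rewrite bigA_distr (bigID (fun E : {set {set 'I_n}} => [forall e in E, #|e| == 2%N])) /=.
rewrite [X in _ + X]big1 ?addr0 => [|E]; last first.
  rewrite negb_forall => /existsP[e]; rewrite negb_imply => /andP[eE e2].
  by rewrite (bigD1 e) //= eE (negPf e2) mul0r.
rewrite (reindex_omap (J := sgraph 'I_n) val insub) /= => [|E]; last first.
  by move=> h; rewrite insubT.
apply: eq_big => [G|G _]; first by rewrite valK eqxx andbT; have := valP G => ->.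
rewrite [LHS]big_mkcond; apply: eq_bigr => e _.
case: ifP => [_|e2]; first by case: ifP.
by case: ifP => // eG; have /forall_inP/(_ _ eG) := valP G; rewrite e2.
Qed.

(** Independence of the pairs: the mean of a product of functions of single pairs is the product of
    their means. *)
Lemma Gnp_weight_prod (g : {set 'I_n} -> bool -> R) :
  \sum_(G : sgraph 'I_n) Gnp_weight p G * \prod_(e : {set 'I_n} | #|e| == 2%N) g e (e \in val G) =
  \prod_(e : {set 'I_n} | #|e| == 2%N) (p * g e true + (1 - p) * g e false).
Proof.
rewrite -(sum_sgraph_prod (fun e b => (if b then p else 1 - p) * g e b)).
by apply: eq_bigr => G _; rewrite -big_split.
Qed.

Lemma Gnp_prob_total : P predT = 1.
Proof.
have := Gnp_weight_prod (fun _ _ => 1).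
rewrite [RHS]big1 => [<-|e _]; last by ring.
by apply: eq_bigr => G _; rewrite big1 ?mulr1.
Qed.

Lemma Gnp_probC A : P A = 1 - P (predC A).
Proof. by rewrite -Gnp_prob_total /Gnp_prob [X in X - _](bigID A) /= addrK. Qed.

Hypothesis p01 : 0 <= p <= 1.
Let p0 : 0 <= p. Proof. by case/andP: p01. Qed.
Let q0 : 0 <= 1 - p. Proof. by case/andP: p01; lra. Qed.

Lemma Gnp_weight_ge0 G : 0 <= Gnp_weight p G.
Proof. by apply: prodr_ge0 => e _; case: ifP. Qed.

Lemma Gnp_prob_ge0 A : 0 <= P A.
Proof. by apply: sumr_ge0 => G _; apply: Gnp_weight_ge0. Qed.

Lemma Gnp_prob_mean A : P A = \sum_(G : sgraph 'I_n) Gnp_weight p G * (A G)%:R.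
Proof. by rewrite /Gnp_prob big_mkcond; apply: eq_bigr => G _; case: (A G); rewrite ?mulr1 ?mulr0. Qed.

Lemma Gnp_prob_le A B : (forall G, A G -> B G) -> P A <= P B.
Proof.
move=> AB; rewrite !Gnp_prob_mean; apply: ler_sum => G _.
by apply: (ler_wpM2l (Gnp_weight_ge0 G)); rewrite ler_nat; move/implyP: (AB G); do 2!case: (_ G).
Qed.

Lemma Gnp_prob_union (I : finType) (C : pred I) A (B : I -> pred (sgraph 'I_n)) :
  (forall G, A G -> exists2 i, C i & B i G) -> P A <= \sum_(i | C i) P (B i).
Proof.
move=> AB; rewrite (eq_bigr _ (fun i _ => Gnp_prob_mean (B i))) exchange_big Gnp_prob_mean.
apply: ler_sum => G _; rewrite -mulr_sumr; apply: (ler_wpM2l (Gnp_weight_ge0 G)).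
have [/AB[i Ci Bi]|_] := boolP (A G); last by apply: sumr_ge0.
by rewrite (bigD1 i) //= Bi lerDl sumr_ge0.
Qed.

Lemma slots_prod S (a b : R) : S \subset slots n ->
  \prod_(e : {set 'I_n} | #|e| == 2%N) (if e \in S then a else b) = a ^+ #|S| * b ^+ #|slots n :\: S|.
Proof.
move=> sS; rewrite (bigID (mem S)) /=; congr (_ * _).
  rewrite -prodr_const; apply: eq_big => [e|e /andP[_ ->]] //.
  by have := subsetP sS e; rewrite inE; case: (e \in S) => [->|] //; rewrite andbF.
rewrite -prodr_const; apply: eq_big => [e|e /andP[_ /negPf->]] //.
by rewrite !inE andbC.
Qed.

Lemma slots_prod1 S (a : R) : S \subset slots n ->
  \prod_(e : {set 'I_n} | #|e| == 2%N) (if e \in S then a else 1) = a ^+ #|S|.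
Proof. by move=> sS; rewrite slots_prod // expr1n mulr1. Qed.

(** This is the generating function of the number of edges in [F] on the event that all of [T] is
    present. As [T] and [F] are disjoint, each pair contributes one of [p], [1 - p + p * K] and
    1. *)
Lemma Gnp_mean_edges T F (K : R) : T \subset slots n -> F \subset slots n -> [disjoint T & F] ->
  \sum_(G : sgraph 'I_n) Gnp_weight p G * ((T \subset val G)%:R * K ^+ #|val G :&: F|) =
  p ^+ #|T| * (1 - p + p * K) ^+ #|F|.
Proof.
move=> sT sF dTF.
pose g e (b : bool) : R := (if e \in F then (if b then K else 1) else 1) *
  (if e \in T then b%:R else 1).
transitivity (\sum_(G : sgraph 'I_n) Gnp_weight p G * \prod_(e : {set 'I_n} | #|e| == 2%N) g e (e \in val G)).
  apply: eq_bigr => G _; congr (_ * _); rewrite big_split mulrC /=; congr (_ * _).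
    rewrite -slots_prod1; last by apply: subset_trans (edges_sub G); apply: subsetIl.
    by apply: eq_bigr => e _; rewrite inE andbC; case: (e \in F).
  have [TG|/subsetPn[e eT eG]] := boolP (T \subset val G).
    by rewrite big1 // => e _; case: ifP => // /(subsetP TG)->.
  rewrite (bigD1 e) /=; first by rewrite eT (negPf eG) mul0r.
  by have := subsetP sT _ eT; rewrite inE.
rewrite Gnp_weight_prod -(slots_prod1 _ sT) -(slots_prod1 _ sF) -big_split.
apply: eq_bigr => e _ /=; rewrite /g.
have /pred0P/(_ e) /= := dTF; case: (e \in T); case: (e \in F) => //= _; ring.
Qed.

(** Markov's inequality for [K ^+ #|val G :&: F|]: it makes many edges in [F] unlikely when [K > 1],
    and few edges when [K < 1]. *)
Lemma Gnp_prob_edges A T F (K c : R) : T \subset slots n -> F \subset slots n -> [disjoint T & F] ->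
  0 <= K -> (forall G, A G -> T \subset val G /\ c <= K ^+ #|val G :&: F|) ->
  c * P A <= p ^+ #|T| * (1 - p + p * K) ^+ #|F|.
Proof.
move=> sT sF dTF K0 h; rewrite -Gnp_mean_edges // Gnp_prob_mean mulr_sumr.
apply: ler_sum => G _; rewrite mulrCA; apply: (ler_wpM2l (Gnp_weight_ge0 G)).
have [/h[-> cK]|_] := boolP (A G); first by rewrite mulr1 mul1r.
by rewrite mulr0 mulr_ge0 // exprn_ge0.
Qed.

(** Given the pairs outside [F], at most one outcome on [F] lies in [A], and its probability is a
    product of factors at most [q]. *)
Lemma Gnp_prob_determined A F (q : R) : F \subset slots n -> p <= q -> 1 - p <= q ->
  (forall G H, A G -> A H -> val G :\: F = val H :\: F -> G = H) ->
  P A <= q ^+ #|F|.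
Proof.
move=> sF pq qq inj.
have qq0 : 0 <= q by apply: le_trans p0 pq.
pose w G := \prod_(e : {set 'I_n} | #|e| == 2%N) (if e \in F then 1 else if e \in val G then p else 1 - p).
have w0 G : 0 <= w G by apply: prodr_ge0 => e _; case: ifP => // _; case: ifP.
have le_w G : Gnp_weight p G <= q ^+ #|F| * w G.
  rewrite -slots_prod1 // -big_split; apply: ler_prod => e _ /=.
  by case: (e \in F); case: (e \in val G); rewrite ?mulr1 ?mul1r ?p0 ?q0 ?lexx.
apply: (@le_trans _ _ (\sum_(G | A G) q ^+ #|F| * w G)); first by apply: ler_sum.
rewrite -mulr_sumr -[leRHS]mulr1; apply: ler_wpM2l; first exact: exprn_ge0.
have offF (G : sgraph 'I_n) : [forall e in val G :\: F, #|e| == 2%N].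
  by apply/forall_inP => e /[!inE]/andP[_ eG]; have /forall_inP/(_ _ eG) := valP G.
pose off G : sgraph 'I_n := exist _ (val G :\: F) (offF G).
have w_off G : w (off G) = w G.
  by apply: eq_bigr => e _; rewrite /= inE; case: (e \in F).
have -> : \sum_(G | A G) w G = \sum_(H in [set off G | G in A]) w H.
  rewrite big_imset => [|G H AG AH]; first by apply: eq_bigr => G _; rewrite w_off.
  by move/(congr1 val)=> /=; apply: inj.
(* These factors forbid edges in [F], so that [w] summed over the graphs without edges in [F]
   becomes a product of factors 1. *)
pose f e b : R := if e \in F then (~~ b)%:R else if b then p else 1 - p.
apply: (@le_trans _ _ (\sum_(H : sgraph 'I_n) \prod_(e : {set 'I_n} | #|e| == 2%N) f e (e \in val H))); last first.
  rewrite sum_sgraph_prod big1 // => e _; rewrite /f; case: ifP => _ /=; ring.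
rewrite [leRHS](bigID (mem [set off G | G in A])) /= -[leLHS]addr0.
apply: lerD; last first.
  apply: sumr_ge0 => G _; apply: prodr_ge0 => e _; rewrite /f.
  by do 2!case: ifP => //.
apply: ler_sum => H /imsetP[G _ ->]; rewrite le_eqVlt; apply/orP; left; apply/eqP.
by apply: eq_bigr => e _; rewrite /f /= inE; case: (e \in F).
Qed.

End Probability.

(** * Random graphs with np tending to infinity *)

Lemma sgraph_ext (V : finType) (G H : sgraph V) :
  (forall x y, x != y -> adj G x y = adj H x y) -> G = H.
Proof.
move=> h; apply: val_inj; apply/setP => e; apply/idP/idP => /[dup] /edgeP[x [y [-> xy _]]].
  by have := h x y xy; rewrite /adj => ->.
by have := h x y xy; rewrite /adj => <-.
Qed.

Definition slots_between n (A B : {set 'I_n}) : {set {set 'I_n}} := [set [set x; y] | x in A, y in B].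

Lemma slots_between_sub n (A B : {set 'I_n}) : [disjoint A & B] -> slots_between A B \subset slots n.
Proof.
move=> dAB; apply/subsetP => e /imset2P[x y xA yB ->]; rewrite inE cards2.
by case: (eqVneq x y) => // xy; have /pred0P/(_ x) := dAB; rewrite /= xA xy yB.
Qed.

Lemma card_slots_between n (A B : {set 'I_n}) : [disjoint A & B] ->
  #|slots_between A B| = (#|A| * #|B|)%N.
Proof.
move=> dAB; rewrite /slots_between curry_imset2X card_in_imset ?cardsX // => -[x y] [z w] /=.
rewrite !inE /= => /andP[xA yB] /andP[zA wB] /eq_set2[][ex ey]; first by rewrite ex ey.
by have /pred0P/(_ x) := dAB; rewrite /= xA ex wB.
Qed.

Lemma card_set_ord m : #|{: {set 'I_m}}| = (2 ^ m)%N.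
Proof. by rewrite -cardsT -powersetT card_powerset cardsT card_ord. Qed.

Section RankWidthTail.
Variables (R : realType) (n : nat) (p q : R).
Hypotheses (p01 : 0 <= p <= 1) (pq : p <= q) (cq : 1 - p <= q) (q1 : q <= 1).

(** By [cut_unique], the pairs between [A :\: I] and [~: A :\: J] are determined by all the
    others. *)
Lemma Gnp_prob_spanned (A I J : {set 'I_n}) : I \subset A -> J \subset ~: A ->
  Gnp_prob p (fun G => `[< spanned G A I J >]) <= q ^+ (#|A :\: I| * #|~: A :\: J|).
Proof.
move=> sI sJ; have dis : [disjoint A :\: I & ~: A :\: J].
  rewrite disjoints_subset; apply/subsetP => x; rewrite !inE => /andP[_ ->].
  by rewrite andbF.
rewrite -card_slots_between //; apply: Gnp_prob_determined => //; first exact: slots_between_sub.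
move=> G H /asboolP[_ [d ed]] /asboolP[[c ec] _] GH.
have same x y : ~~ ((x \in A :\: I) && (y \in ~: A :\: J)) -> ~~ ((y \in A :\: I) && (x \in ~: A :\: J)) ->
    adj G x y = adj H x y.
  move=> h1 h2; have : [set x; y] \notin slots_between (A :\: I) (~: A :\: J).
    apply/negP => /imset2P[a b aA bB /eq_set2[][ex ey]]; subst.
      by rewrite aA bB in h1.
    by rewrite aA bB in h2.
  move=> nF; have := congr1 (fun E : {set {set 'I_n}} => [set x; y] \in E) GH.
  by rewrite !inE (negPf nF).
have cross := @cut_unique _ G H A (~: A) I J c c d d sI sJ ec ed.
apply: sgraph_ext => x y xy.
have key a b : a \in A -> b \in ~: A -> adj G a b = adj H a b.
  apply: cross => {}a {}b aA bA ij; apply: same.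
    by rewrite !inE negb_and !negb_and !negbK; case/orP: ij => ->; rewrite ?orbT.
  by move: bA; rewrite !inE => /negPf->; rewrite andbF.
have [xA|xA] := boolP (x \in A); have [yA|yA] := boolP (y \in A).
- by apply: same; rewrite !inE xA yA /= !andbF.
- by apply: key; rewrite ?inE.
- by rewrite adj_sym [RHS]adj_sym; apply: key; rewrite ?inE.
- by apply: same; rewrite !inE (negPf xA) (negPf yA) /= !andbF.
Qed.

(** A union bound over at most [8 ^ n] triples, each contributing at most [q ^+ (s * n)]. *)
Lemma Gnp_prob_rank_width r s : (2 < n)%N -> (3 * r + 18 * s <= n)%N ->
  Gnp_prob p (fun G : sgraph 'I_n => (rank_width G <= r)%N) <= (8 * q ^+ s) ^+ n.
Proof.
move=> n2 rs; have q0 : 0 <= q by apply: le_trans pq; case/andP: p01.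
pose C (t : {set 'I_n} * {set 'I_n} * {set 'I_n}) :=
  [&& n <= 3 * #|t.1.1|, n <= 3 * #|~: t.1.1|, t.1.2 \subset t.1.1, t.2 \subset ~: t.1.1, #|t.1.2| <= r & #|t.2| <= r]%N.
apply: le_trans (@Gnp_prob_union _ _ _ p01 _ C _ (fun t G => `[< spanned G t.1.1 t.1.2 t.2 >]) _) _.
  move=> G /rank_width_spanned; rewrite card_ord => /(_ n2)[A [I [J [h1 h2 h3 h4 [h5 h6 h7]]]]].
  by exists (A, I, J); [rewrite /C /= h1 h2 h3 h4 h5 h6|apply/asboolP].
apply: (@le_trans _ _ (\sum_(t | C t) q ^+ (s * n))).
  apply: ler_sum => -[[A I] J] /and5P[/= h1 h2 h3 h4 /andP[h5 h6]].
  apply: le_trans (Gnp_prob_spanned h3 h4) _.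
  apply: ler_wiXn2l => //.
  have cA := cardsC A; rewrite card_ord in cA.
  have := cardsD A I; rewrite (setIidPr h3) => e1.
  have := cardsD (~: A) J; rewrite (setIidPr h4) => e2.
  set x := #|A :\: I| in e1 *; set y := #|~: A :\: J| in e2 *.
  have {}h1 : (n <= 3 * #|A|)%N := h1.
  have {}h2 : (n <= 3 * #|~: A|)%N := h2.
  have {}h5 : (#|I| <= r)%N := h5.
  have {}h6 : (#|J| <= r)%N := h6.
  have x1 : (6 * s <= x)%N by clear -h1 h5 e1 rs; lia.
  have y1 : (6 * s <= y)%N by lia.
  (* Both [x] and [y] are at least [6 * s]; their sum is at least [n - 2 * r >= n / 3], so one of
     them is at least [n / 6]. *)
  have [xy|xy] : (n <= 6 * x)%N \/ (n <= 6 * y)%N by lia.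
    by have := leq_mul xy y1; lia.
  by have := leq_mul xy x1; lia.
apply: (@le_trans _ _ (\sum_(t : {set 'I_n} * {set 'I_n} * {set 'I_n}) q ^+ (s * n))).
  by rewrite [leRHS](bigID C) /= lerDl; apply: sumr_ge0 => *; apply: exprn_ge0.
rewrite sumr_const !card_prod !card_set_ord -!expnMn -[(2 * 2 * 2)%N]/8%N exprM exprMn -[leLHS]mulr_natl.
by rewrite natrX.
Qed.
End RankWidthTail.

(** * From tail bounds to asymptotic statements *)

Section AsymptoticallyAlmostSurely.
Variable R : realType.
Implicit Types (p b : nat -> R).
Local Open Scope classical_set_scope.

Lemma aas_of_bound p (A : forall n, pred (sgraph 'I_n)) b :
  (\forall n \near \oo, 0 <= p n <= 1) ->
  (\forall n \near \oo, Gnp_prob (p n) (predC (@A n)) <= b n) ->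
  b n @[n --> \oo] --> 0 -> aas p A.
Proof.
move=> p01 Ab b0; rewrite /aas.
apply: (@squeeze_cvgr _ _ _ _ (fun n => 1 - b n) (fun=> 1)).
- near=> n; have pn : 0 <= p n <= 1 by near: n.
  have := @Gnp_prob_ge0 _ _ _ pn (predC (@A n)).
  have : Gnp_prob (p n) (predC (A n)) <= b n by near: n.
  by rewrite (Gnp_probC _ (@A n)); lra.
- by rewrite -[X in _ --> X](subr0 1); apply: cvgB => //; apply: cvg_cst.
exact: cvg_cst.
Unshelve. all: by end_near.
Qed.

Lemma rank_width_near_third n (G : sgraph 'I_n) s : (2 < n)%N -> (18 * s <= n)%N ->
  ((n - 18 * s) %/ 3 < rank_width G)%N ->
  `|(rank_width G)%:R - (Num.ceil (n%:R / 3 : R))%:~R| <= (6 * s + 2)%:R :> R.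
Proof.
move=> n2 sn lo; have := @rank_width_third _ G; rewrite card_ord => /(_ n2) up.
have := ceil_itv (n%:R / 3 : R); rewrite intrB mulr1z => /andP[c1 c2].
have lo' : n%:R <= 3 * (rank_width G)%:R + 18 * s%:R :> R by rewrite -!natrM -natrD ler_nat; lia.
have up' : 3 * (rank_width G)%:R <= n%:R + 6 :> R by rewrite -natrM -natrD ler_nat; lia.
rewrite natrD natrM.
move: lo' up'.
rewrite ler_norml; move: c1 c2; set c := (Num.ceil _)%:~R; set w : R := (rank_width G)%:R; set t : R := s%:R; set m : R := n%:R.
have t0 : 0 <= t by [].
move=> *; apply/andP; split; lra.
Qed.

(** With [q n ^+ s n <= 1 / 16], the tail bound becomes [(8 / 16) ^+ n]. A constant [s] serves
    constant [p], a small multiple of [n] serves the sparse range. *)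
Lemma aas_rank_width p q (s : nat -> nat) (A : forall n, pred (sgraph 'I_n)) :
  (\forall n \near \oo, [/\ 0 <= p n <= 1, p n <= q n, 1 - p n <= q n & q n <= 1]) ->
  (\forall n \near \oo, q n ^+ s n <= 1 / 16) ->
  (\forall n \near \oo, (18 * s n <= n)%N) ->
  (\forall n \near \oo, forall G : sgraph 'I_n,
     `|(rank_width G)%:R - (Num.ceil (n%:R / 3 : R))%:~R| <= (6 * s n + 2)%:R :> R -> A n G) ->
  aas p A.
Proof.
move=> hp hq hs hA; apply: (@aas_of_bound _ _ (fun n => (1 / 2) ^+ n)).
- by near=> n; have [] : [/\ 0 <= p n <= 1, p n <= q n, 1 - p n <= q n & q n <= 1] by near: n.
- near=> n; have [p01 pq cq q1] : [/\ 0 <= p n <= 1, p n <= q n, 1 - p n <= q n & q n <= 1] by near: n.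
  have n2 : (2 < n)%N by near: n; exists 3%N.
  have sn : (18 * s n <= n)%N by near: n.
  have qs : q n ^+ s n <= 1 / 16 by near: n.
  have nA : forall G : sgraph 'I_n, `|(rank_width G)%:R - (Num.ceil (n%:R / 3 : R))%:~R| <= (6 * s n + 2)%:R :> R -> A n G by near: n.
  have q0 : 0 <= q n by apply: le_trans pq; case/andP: p01.
  have rs : (3 * ((n - 18 * s n) %/ 3) + 18 * s n <= n)%N by lia.
  apply: le_trans (Gnp_prob_le p01 _) _; last first.
    apply: le_trans (Gnp_prob_rank_width p01 pq cq q1 n2 rs) _.
    have h0 : 0 <= q n ^+ s n by apply: exprn_ge0.
    by apply: lerXn2r; rewrite ?nnegrE; lra.
  by move=> G; apply: contraNT; rewrite -ltnNge => /(rank_width_near_third n2 sn); apply: nA.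
by apply: cvg_expr; rewrite ger0_norm; lra.
Unshelve. all: by end_near.
Qed.

Lemma exists_expr_le (q e : R) : 0 <= q < 1 -> 0 < e -> exists s, q ^+ s <= e.
Proof.
case/andP=> q0 q1 e0; have : q ^+ n @[n --> \oo] --> 0 by apply: cvg_expr; rewrite ger0_norm.
move=> /cvgr0_norm_le/(_ e e0)[s _ h]; exists s.
by have := h s (leqnn _); rewrite /= ger0_norm // exprn_ge0.
Qed.

Lemma aas_rank_width_constant (p : R) : 0 < p < 1 -> exists C : R, aas (fun=> p) (fun n G =>
  `|(rank_width G)%:R - (Num.ceil (n%:R / 3 : R))%:~R| <= C).
Proof.
case/andP=> p0 p1; set q := Num.max p (1 - p).
have [s hs] : exists s, q ^+ s <= 1 / 16.
  by apply: exists_expr_le; [rewrite /q le_max gt_max; apply/andP; split; [lra|apply/andP; split; lra]|lra].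
exists (6 * s + 2)%:R; apply: (@aas_rank_width _ (fun=> q) (fun=> s)).
- near=> n; rewrite /q !le_max !ge_max !lexx ?orbT; split; lra.
- by near=> n.
- by exists (18 * s)%N.
- by near=> n.
Unshelve. all: by end_near.
Qed.

Lemma aas_rank_width_sparse p : (forall n, 0 <= p n <= 1 / 2) -> (n%:R * p n @[n --> \oo] --> +oo) ->
  forall eps : R, 0 < eps -> aas p (fun n G =>
    `|(rank_width G)%:R - (Num.ceil (n%:R / 3 : R))%:~R| <= eps * n%:R).
Proof.
move=> p12 np eps eps0; set d := Num.min eps 1.
have d0 : 0 < d by rewrite lt_min eps0 ltr01.
have [de d1] : d <= eps /\ d <= 1 by rewrite !ge_min !lexx orbT.
(* [6 * s n] is at most a third of [eps * n], which leaves room for the summand 2 once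
   [n >= 3 / eps]; capping [d] at 1 ensures [18 * s n <= n]. *)
pose s n := Num.truncn (d * n%:R / 18).
have sP n : (s n)%:R <= d * n%:R / 18 < (s n)%:R + 1.
  have h0 : 0 <= d * n%:R / 18 by rewrite divr_ge0 // mulr_ge0 // ltW.
  by rewrite natr1; exact: truncn_itv h0.
apply: (@aas_rank_width _ (fun n => 1 - p n) s).
- by near=> n; have := p12 n; split; lra.
- near=> n; have /andP[pn0 pn1] := p12 n.
  (* This makes [p n * (d * n / 18)] at least 16. Rounding to [s n] costs less than 1, so
     [expR (p n * s n) >= 1 + p n * s n >= 16]. *)
  have npn : 18 * 16 / d <= n%:R * p n by near: n; move: (18 * 16 / d); apply/cvgryPge.
  apply: (@le_trans _ _ (expR (- p n) ^+ s n)).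
    apply: lerXn2r; rewrite ?nnegrE; [lra|exact: expR_ge0|exact: expR_ge1Dx].
  rewrite -expRM_natl mulrN expRN div1r lef_pV2 ?posrE ?expR_gt0 //.
  apply: le_trans (expR_ge1Dx _); have /andP[_ s2] := sP n.
  have : 16 <= p n * (d * n%:R / 18).
    move: npn; rewrite ler_pdivrMr //; lra.
  move: s2; set S := (s n)%:R; move: (d * _ / 18) => u; nra.
- near=> n; have /andP[s1 _] := sP n; rewrite -(ler_nat R) natrM.
  have : d * n%:R <= n%:R by rewrite -[leRHS]mul1r ler_wpM2r.
  by move: s1; set S := (s n)%:R; lra.
near=> n => G /le_trans; apply; have /andP[s1 _] := sP n.
rewrite natrD natrM; have : 3 / eps <= n%:R by near: n; apply: nbhs_infty_ger.
rewrite ler_pdivrMr // => e3.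
have : d * n%:R <= eps * n%:R by rewrite ler_wpM2r.
by move: s1; set S := (s n)%:R; lra.
Unshelve. all: by end_near.
Qed.

End AsymptoticallyAlmostSurely.

(** * Subcritical random graphs *)

Section LassoCount.
Variables (n k : nat).
Implicit Types (t : k.+1.-tuple 'I_n) (a b : 'I_k.+1).

(** Positions on the path: those of the extra edge from the first vertex to [a], of the one from the
    last vertex to [b], and of the [k] path edges. *)
Definition lasso_indices a b : {set 'I_k.+1 * 'I_k.+1} :=
  (ord0, a) |: ((b, ord_max) |: [set (inord i, inord i.+1) | i : 'I_k]).

Definition lasso_edges t a b : {set {set 'I_n}} :=
  [set [set tnth t ij.1; tnth t ij.2] | ij in lasso_indices a b].

(** The extra edges are not path edges and do not coincide. *)
Definition lasso_shape a b := [&& 1 < a, b.+1 < k & ~~ ((a == k :> nat) && (b == 0 :> nat))]%N.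

Lemma card_lasso_indices a b : lasso_shape a b -> #|lasso_indices a b| = k.+2.
Proof.
case/and3P=> a1 bk ab; rewrite !cardsU1 card_in_imset => [|i j _ _ []]; last first.
  move/(congr1 (@nat_of_ord _)); rewrite !inordK ?(leqW (ltn_ord _)) // => h _; exact: val_inj.
rewrite card_ord !inE xpair_eqE negb_or.
have nin (x y : 'I_k.+1) : (y != x.+1 :> nat)%N -> (x, y) \notin [set (inord i : 'I_k.+1, inord i.+1 : 'I_k.+1) | i : 'I_k].
  apply: contraNN => /imsetP[i _ [-> ->]]; rewrite !inordK ?ltnS //; exact: ltnW.
have n1 : (ord0, a) \notin [set (inord i : 'I_k.+1, inord i.+1 : 'I_k.+1) | i : 'I_k].
  by apply: nin; rewrite neq_ltn a1 orbT.
have n2 : (b, ord_max) \notin [set (inord i : 'I_k.+1, inord i.+1 : 'I_k.+1) | i : 'I_k].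
  by apply: nin; rewrite neq_ltn bk orbT.
rewrite n1 n2 andbT.
have -> : ~~ ((ord0 == b) && (a == ord_max)) by apply: contraNN ab => /andP[/eqP<- /eqP->]; rewrite /= !eqxx.
by lia.
Qed.

(** Increasing pairs can be recovered from unordered ones, so distinct index pairs give distinct
    edges on a repetition-free tuple. *)
Lemma lasso_indices_lt a b ij : lasso_shape a b -> ij \in lasso_indices a b -> (ij.1 < ij.2)%N.
Proof.
case/and3P=> a1 bk _; rewrite !inE => /or3P[/eqP->|/eqP->|/imsetP[i _ ->]] /=.
- exact: ltnW.
- exact: leq_trans (ltnSn _) (ltnW _).
- by rewrite !inordK ?ltnS //; apply: ltnW.
Qed.

Lemma card_lasso_edges t a b : uniq t -> lasso_shape a b -> #|lasso_edges t a b| = k.+2.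
Proof.
move=> /tuple_uniqP ut ab; rewrite card_in_imset ?card_lasso_indices // => -[i j] [i' j'] /=.
move=> /(lasso_indices_lt ab) /= ij /(lasso_indices_lt ab) /= ij' /eq_set2[][/ut ei /ut ej].
  by rewrite ei ej.
by move: ij ij'; rewrite ei ej; lia.
Qed.

Lemma lasso_edges_sub t a b : uniq t -> lasso_shape a b -> lasso_edges t a b \subset slots n.
Proof.
move=> /tuple_uniqP ut ab; apply/subsetP => e /imsetP[[i j] /(lasso_indices_lt ab) /= ij ->].
by rewrite inE cards2 (inj_eq ut) neq_ltn ij.
Qed.

End LassoCount.

Lemma double_lasso_tuple n (G : sgraph 'I_n) x p a b : double_lasso G x p a b ->
  exists k, (k < n)%N /\ exists (t : k.+1.-tuple 'I_n) (a b : 'I_k.+1),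
    [&& uniq t, lasso_shape a b & lasso_edges t a b \subset val G].
Proof.
case=> pp up /andP[/andP[a1 ak] bk] ab /andP[xa lb].
have kn : (size p < n)%N by have := max_card (mem (x :: p)); rewrite (card_uniqP up) card_ord.
have bk' : (b < (size p).+1)%N by move: bk => /=; lia.
exists (size p); split=> //; exists (in_tuple (x :: p)), (Ordinal ak), (Ordinal bk').
have nthE i : tnth (in_tuple (x :: p)) i = nth x (x :: p) i by apply: tnth_nth.
rewrite up /=; apply/andP; split.
  by rewrite /lasso_shape /= a1 ab andbT; move: bk => /=; lia.
apply/subsetP => e /imsetP[[i j] h ->] /=; rewrite -/(adj G _ _) !nthE.
move: h; rewrite !inE => /or3P[/eqP[-> ->]|/eqP[-> ->]|/imsetP[l _ [-> ->]]] //.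
  by rewrite adj_sym; move: lb; rewrite -[last x p]/(last x (x :: p)) -nth_last.
rewrite !inordK ?ltnS //; last exact: ltnW.
by have /(pathP x)/(_ l) := pp; apply.
Qed.

Section LassoProbability.
Variable R : realType.

(** For each [k] there are at most [n ^ k.+1] paths and [k.+1 ^ 2] pairs of extra edges, and [k.+2]
    edges are prescribed. *)
Lemma Gnp_prob_lasso n (p : R) : 0 <= p <= 1 ->
  Gnp_prob p (fun G : sgraph 'I_n => (2 < rank_width G)%N) <=
  \sum_(k < n) (n ^ k.+1 * (k.+1) ^ 2)%:R * p ^+ k.+2.
Proof.
move=> p01.
pose B (k : nat) (y : k.+1.-tuple 'I_n * 'I_k.+1 * 'I_k.+1) (G : sgraph 'I_n) :=
  [&& uniq y.1.1, lasso_shape y.1.2 y.2 & lasso_edges y.1.1 y.1.2 y.2 \subset val G].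
pose C (k : nat) (G : sgraph 'I_n) := [exists y, B k y G].
apply: le_trans (@Gnp_prob_union _ _ _ p01 _ (fun=> true) _ (fun (k : 'I_n) G => C k G) _) _.
  move=> G; rewrite ltnNge => /negP rw.
  have [|nl] := pselect (exists x p a b, double_lasso G x p a b); last first.
    by case: rw; apply: rank_width_no_lasso => x q a b dl; apply: nl; exists x, q, a, b.
  move=> [x [q [a [b /double_lasso_tuple[k [kn [t [a' [b' h]]]]]]]]].
  by exists (Ordinal kn) => //=; apply/existsP; exists (t, a', b').
apply: ler_sum => k _.
apply: le_trans (@Gnp_prob_union _ _ _ p01 _ (fun=> true) _ (B k) _) _.
  by move=> G /existsP[y By]; exists y.
apply: (@le_trans _ _ (\sum_(y : k.+1.-tuple 'I_n * 'I_k.+1 * 'I_k.+1) p ^+ k.+2)); last first.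
  by rewrite sumr_const !card_prod card_tuple !card_ord -[leLHS]mulr_natl -mulnA mulnn.
apply: ler_sum => -[[t a] b] _.
have [/andP[ut ab]|no] := boolP (uniq t && lasso_shape a b); last first.
  rewrite /Gnp_prob big_pred0 => [|G]; first by apply: exprn_ge0; case/andP: p01.
  by rewrite /B /= andbA (negPf no).
have := @Gnp_prob_edges _ _ _ p01 (B k (t, a, b)) _ set0 1 1 (lasso_edges_sub ut ab) (sub0set _).
rewrite mul1r cards0 expr0 mulr1 card_lasso_edges //; apply => //.
  by rewrite disjoint_sym disjoints_subset sub0set.
by move=> G /and3P[_ _ h]; rewrite expr1n.
Qed.

(** This is Bernoulli's inequality. Of the three resulting geometric factors, two absorb a quadratic
    factor through [mulrn_expr_le] and the third keeps the decay. *)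
Lemma le_cube_third (v : R) : 0 <= v <= 1 -> v <= (1 - (1 - v) / 3) ^+ 3.
Proof.
case/andP=> v0 v1; set w := (1 - v) / 3; have -> : v = 1 - 3 * w by rewrite /w; lra.
have : 0 <= w ^+ 2 * (3 - w) by rewrite mulr_ge0 ?sqr_ge0 // /w; lra.
by rewrite !exprS expr0; lra.
Qed.

(** Each of the [m] copies of [u ^+ m] is at most a term [u ^+ i] of the geometric sum. *)
Lemma mulrn_expr_le (u : R) m : 0 <= u < 1 -> m%:R * u ^+ m <= (1 - u)^-1.
Proof.
case/andP=> u0 u1; rewrite -[leRHS]mul1r ler_pdivlMr; last by rewrite subr_gt0.
have -> : m%:R * u ^+ m = \sum_(i < m) u ^+ m by rewrite sumr_const card_ord mulr_natl.
apply: (@le_trans _ _ ((\sum_(i < m) u ^+ i) * (1 - u))).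
  apply: ler_wpM2r; first by rewrite subr_ge0 ltW.
  by apply: ler_sum => i _; apply: ler_wiXn2l => //; [exact: ltW|exact: ltnW].
rewrite mulrC -[X in X * _]opprB mulNr -subrX1 opprB gerBl.
exact: exprn_ge0.
Qed.

Lemma sum_expr_le (u : R) m : 0 <= u < 1 -> \sum_(i < m) u ^+ i <= (1 - u)^-1.
Proof.
case/andP=> u0 u1; rewrite -[leRHS]mul1r ler_pdivlMr; last by rewrite subr_gt0.
rewrite mulrC -[X in X * _]opprB mulNr -subrX1 opprB gerBl.
exact: exprn_ge0.
Qed.

Local Open Scope classical_set_scope.

Lemma aas_rank_width_subcritical (c : R) (p : nat -> R) : c < 1 -> (forall n, 0 <= p n <= 1) ->
  (forall n, (0 < n)%N -> p n <= c / n%:R) -> aas p (fun n G => (rank_width G <= 2)%N).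
Proof.
move=> c1 p01 pc; pose d := Num.max c (1 / 2).
have [d0 d1 cd] : [/\ 0 < d, d < 1 & c <= d].
  by rewrite /d lt_max gt_max le_max lexx; split=> //; [apply/orP; right; lra|apply/andP; split; lra].
pose u := 1 - (1 - d) / 3.
have u01 : 0 <= u < 1 by rewrite /u; apply/andP; split; lra.
have du : d <= u ^+ 3 by apply: le_cube_third; rewrite !ltW.
apply: (@aas_of_bound _ _ _ (fun n => (1 - u)^-1 ^+ 3 / n%:R)).
- by near=> n.
- near=> n; have n0 : (0 < n)%N by near: n; exists 1%N.
  apply: (@le_trans _ _ (Gnp_prob (p n) (fun G : sgraph 'I_n => (2 < rank_width G)%N))).
    by apply: Gnp_prob_le => // G; rewrite /= -ltnNge.
  apply: le_trans (Gnp_prob_lasso _ (p01 n)) _.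
  have nR : 0 < n%:R :> R by rewrite ltr0n.
  rewrite ler_pdivlMr // mulr_suml exprS.
  apply: (@le_trans _ _ (\sum_(k < n) (1 - u)^-1 ^+ 2 * u ^+ k)); last first.
    rewrite -mulr_sumr mulrC; apply: ler_wpM2r; last exact: sum_expr_le.
    by rewrite exprn_ge0 // invr_ge0; case/andP: u01; lra.
  apply: ler_sum => k _.
  have pnd : n%:R * p n <= d by rewrite mulrC -ler_pdivlMr //; apply: le_trans (pc _ n0) _; rewrite ler_wpM2r // invr_ge0 ltW.
  have pn0 : 0 <= p n by case/andP: (p01 n).
  (* The spare factor [n], from the denominator of the target bound, lets every [p n] be paired with
     an [n]. *)
  have -> : (n ^ k.+1 * k.+1 ^ 2)%:R * p n ^+ k.+2 * n%:R = (k.+1)%:R ^+ 2 * (n%:R * p n) ^+ k.+2 :> R.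
    by rewrite exprMn natrM !natrX (exprS n%:R k.+1); ring.
  apply: (@le_trans _ _ ((k.+1)%:R ^+ 2 * (u ^+ 3) ^+ k.+1)).
    rewrite ler_wpM2l ?exprn_ge0 //; apply: (@le_trans _ _ (d ^+ k.+2)).
      by apply: lerXn2r; rewrite ?nnegrE ?mulr_ge0 // ltW.
    apply: (@le_trans _ _ (d ^+ k.+1)); first by apply: ler_wiXn2l; rewrite // ltW.
    apply: lerXn2r => //; rewrite nnegrE; [exact: ltW|apply: exprn_ge0; by case/andP: u01].
  have /andP[u0 u1] := u01.
  have -> : (k.+1)%:R ^+ 2 * (u ^+ 3) ^+ k.+1 = ((k.+1)%:R * u ^+ k.+1) ^+ 2 * (u * u ^+ k) :> R.
    by rewrite -exprM mulnC exprM (exprS u k); ring.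
  apply: ler_pM; rewrite ?exprn_ge0 ?mulr_ge0 ?exprn_ge0 //.
    apply: lerXn2r; last exact: mulrn_expr_le.
      by rewrite nnegrE mulr_ge0 // exprn_ge0.
    by rewrite nnegrE invr_ge0 subr_ge0 ltW.
  by rewrite ler_piMl ?exprn_ge0 // ltW.
rewrite -[X in _ --> X](mulr0 ((1 - u)^-1 ^+ 3)); apply: cvgM; first exact: cvg_cst.
apply/gtr0_cvgV0; [by exists 1%N => // n /= n0; rewrite ltr0n|exact: cvgr_idn].
Unshelve. all: by end_near.
Qed.
End LassoProbability.

(** * Supercritical random graphs *)

Section Supercritical.
Variable R : realType.

Lemma Gnp_prob_or n (p : R) (A B1 B2 B3 : pred (sgraph 'I_n)) : 0 <= p <= 1 ->
  (forall G, A G -> [|| B1 G, B2 G | B3 G]) ->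
  Gnp_prob p A <= Gnp_prob p B1 + Gnp_prob p B2 + Gnp_prob p B3.
Proof.
move=> p01 h; rewrite !Gnp_prob_mean -!big_split /=; apply: ler_sum => G _.
rewrite -!mulrDr; apply: ler_wpM2l; first exact: Gnp_weight_ge0.
rewrite -!natrD ler_nat; move: (h G).
by do 4!case: (_ G) => //=; move=> /(_ isT).
Qed.

(** Markov's inequality with [K = 8 ^+ B]: more than [b] edges have weight at least [8 ^+ n], while
    the at most [s * n] pairs touching a set of [s] vertices have mean weight at most
    [expR (c * K) ^+ s <= 2 ^+ n]. The quotient [(1 / 4) ^+ n] outweighs the [2 ^ n] sets. *)
Lemma Gnp_prob_sparse (c : R) (B : nat) : 0 <= c -> exists2 L : nat, (0 < L)%N &
  forall n s b, (0 < n)%N -> c / n%:R <= 1 -> (n <= B * b)%N -> (L * s <= n)%N ->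
    Gnp_prob (c / n%:R) (fun G : sgraph 'I_n => `[< ~ sparse G s b >]) <= (1 / 2) ^+ n.
Proof.
move=> c0; pose K : R := 8 ^+ B.
have K1 : 1 <= K by apply: exprn_ege1; lra.
(* Equivalently [expR (c * K) <= 2 ^+ L], which turns [L * s <= n] into the bound [2 ^+ n]. *)
have [L0 hL] : exists L, expR (- (c * K)) >= (1 / 2) ^+ L :> R.
  by apply: exists_expr_le; [apply/andP; split; lra|exact: expR_gt0].
exists L0.+1 => // n s b n0 p1 nb sL.
have nR : 0 < n%:R :> R by rewrite ltr0n.
have p01 : 0 <= c / n%:R <= 1 by rewrite p1 divr_ge0.
set p := c / n%:R in p01 *.
pose F (S : {set 'I_n}) : {set {set 'I_n}} := [set e in slots n | e :&: S != set0].
have cF (S : {set 'I_n}) : (#|S| <= s)%N -> (#|F S| <= s * n)%N.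
  move=> Ss; have sub : F S \subset [set [set x; y] | x in S, y in [set: 'I_n]].
    apply/subsetP => e; rewrite !inE => /andP[/cards2P[x [y [_ ->]]] /set0Pn[z]].
    rewrite !inE => /andP[/orP[]/eqP-> zS]; apply/imset2P; first by exists x y; rewrite ?inE.
    by exists y x; rewrite ?inE // setUC.
  apply: leq_trans (subset_leq_card sub) _.
  rewrite curry_imset2X; apply: leq_trans (leq_imset_card _ _) _.
  by rewrite cardsX cardsT card_ord leq_mul2r Ss orbT.
apply: le_trans (@Gnp_prob_union _ _ _ p01 _ (fun S : {set 'I_n} => (#|S| <= s)%N) _
   (fun S G => (b < #|touching G S|)%N) _) _.
  move=> G /asboolP nsp; apply: contrapT => h; apply: nsp => S Ss.
  by rewrite leqNgt; apply/negP => hb; apply: h; exists S.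
have q0 : 0 <= expR (c * K) by apply: expR_ge0.
apply: (@le_trans _ _ (\sum_(S : {set 'I_n} | (#|S| <= s)%N) (1 / 4) ^+ n)); last first.
  apply: (@le_trans _ _ (\sum_(S : {set 'I_n}) (1 / 4) ^+ n)).
    by rewrite [leRHS](bigID (fun S : {set 'I_n} => (#|S| <= s)%N)) /= lerDl; apply: sumr_ge0 => *; apply: exprn_ge0; lra.
  rewrite sumr_const card_set_ord -[leLHS]mulr_natl natrX -exprMn.
  by rewrite le_eqVlt; apply/orP; left; apply/eqP; congr (_ ^+ _); lra.
apply: ler_sum => S Ss.
have sF : F S \subset slots n by apply/subsetP => e /[!inE] /andP[].
have := @Gnp_prob_edges _ _ _ p01 (fun G => (b < #|touching G S|)%N) set0 (F S) K (K ^+ b) (sub0set _) sF.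
rewrite cards0 expr0 mul1r => /(_ _ _ _)/wrap[].
- by rewrite disjoints_subset sub0set.
- by lra.
- move=> G hb; split; first exact: sub0set.
  apply: ler_weXn2l => //; apply: leq_trans (ltnW hb) (subset_leq_card _).
  apply/subsetP => e; rewrite !inE => /andP[eG ->].
  by have /forall_inP/(_ _ eG)-> := valP G; rewrite eG.
move=> h; have h8 : (8 : R) ^+ n <= K ^+ b.
  have -> : K ^+ b = 8 ^+ (B * b) by rewrite exprM.
  by apply: ler_weXn2l => //; rewrite ler1n.
have P0 := Gnp_prob_ge0 p01 (fun G => (b < #|touching G S|)%N).
have {}h : 8 ^+ n * Gnp_prob p (fun G => (b < #|touching G S|)%N) <= 2 ^+ n.
  apply: le_trans (ler_wpM2r P0 h8) _; apply: le_trans h _.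
  apply: (@le_trans _ _ (expR (p * K) ^+ #|F S|)).
    apply: lerXn2r; rewrite ?nnegrE ?expR_ge0 //.
      by case/andP: p01 => *; apply: addr_ge0; [lra|apply: mulr_ge0; lra].
    by apply: le_trans (expR_ge1Dx _); case/andP: p01 => *; lra.
  apply: (@le_trans _ _ (expR (p * K) ^+ (s * n))).
    apply: ler_weXn2l; last exact: cF.
    by rewrite -[leLHS]expR0 ler_expR; case/andP: p01 => *; apply: mulr_ge0 => //; lra.
  have -> : expR (p * K) ^+ (s * n) = expR (c * K) ^+ s.
    by rewrite mulnC exprM -expRM_natl /p; congr (expR _ ^+ _); field; rewrite gt_eqF.
  apply: (@le_trans _ _ ((2 ^+ L0) ^+ s)).
    apply: lerXn2r; rewrite ?nnegrE ?exprn_ge0 //.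
    by move: hL; rewrite expRN div1r exprVn lef_pV2 ?posrE ?expR_gt0 ?exprn_gt0.
  have -> : (2 ^+ L0) ^+ s = 2 ^+ (L0 * s) :> R by rewrite exprM.
  by apply: ler_weXn2l; [rewrite ler1n|apply: leq_trans sL; rewrite leq_mul2r leqnSn orbT].
have -> : (1 / 4 : R) ^+ n = 2 ^+ n / 8 ^+ n by rewrite -expr_div_n; congr (_ ^+ _); lra.
by rewrite ler_pdivlMr ?exprn_gt0 // mulrC.
Qed.

(** The edges from [Z] to parents are prescribed, and [Gnp_prob_edges] with [kappa <= 1] accounts
    for the pairs leaving [W], at most [b] of which are edges. *)
Lemma Gnp_prob_closed_forest_fixed n (p kappa : R) D b j (Z : {set 'I_n}) (g : {ffun 'I_n -> 'I_n}) :
  let W := below n j :|: Z in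
  0 <= p <= 1 -> 0 < kappa <= 1 ->
  kappa ^+ b * Gnp_prob p (fun G => `[< closed_forest G D b j Z g >]) <=
  p ^+ #|Z| * (1 - p + p * kappa) ^+ (#|W| * #|~: W|).
Proof.
move=> W p01 /andP[k0 k1]; have [p0 p1] := andP p01.
have rhs0 : 0 <= p ^+ #|Z| * (1 - p + p * kappa) ^+ (#|W| * #|~: W|).
  by rewrite mulr_ge0 // exprn_ge0 // addr_ge0 ?mulr_ge0 ?subr_ge0 // ltW.
(* One graph with this forest already gives the facts on [Z] and [g] alone, such as the number
   [#|Z|] of forest edges; without one the probability is 0. *)
have [[G0 cf0]|no] := pselect (exists G, closed_forest G D b j Z g); last first.
  rewrite /Gnp_prob big_pred0 ?mulr0 // => G; apply/negbTE; apply/negP => /asboolP cf.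
  by apply: no; exists G.
have [_ _ gZ inj _] := cf0.
pose T := [set [set y; g y] | y in Z].
have dW : [disjoint W & ~: W] by rewrite disjoints_subset setCK.
have cT : #|T| = #|Z| by rewrite card_in_imset.
rewrite -cT -(card_slots_between dW); apply: Gnp_prob_edges => //.
- apply/subsetP => e /imsetP[y /gZ[_ yg] ->].
  by rewrite inE cards2 (adj_neq yg).
- exact: slots_between_sub.
- rewrite disjoints_subset; apply/subsetP => e /imsetP[y yZ ->]; rewrite inE.
  apply/negP => /imset2P[x z xW]; rewrite inE => zW /eq_set2[][ex ez].
    by have [] := gZ _ yZ; rewrite ez (negPf zW).
  by move: zW; rewrite -ex inE yZ orbT.
- exact: ltW.
move=> G /asboolP[_ _ gG _ cG]; split.
  by apply/subsetP => e /imsetP[y /gG[_ yg] ->].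
apply: ler_wiXn2l; rewrite ?(ltW k0) //; apply: leq_trans (subset_leq_card _) cG.
apply/subsetP => e; rewrite !inE => /andP[-> /imset2P[x y xW yW ->]] /=.
by apply/andP; split; apply/set0Pn; [exists x|exists y]; rewrite in_setI ?xW ?yW andbT !inE eqxx ?orbT.
Qed.

(** A union bound over [j], [Z] and [g], where [g] is counted by its values on [Z] only. *)
Lemma Gnp_prob_closed_forest n (p kappa : R) D b : (0 < n)%N -> 0 <= p <= 1 -> 0 < kappa <= 1 ->
  kappa ^+ b * Gnp_prob p (fun G : sgraph 'I_n => `[< exists j Z g, (j <= n)%N /\ closed_forest G D b j Z g >]) <=
  \sum_(j < n.+1) \sum_(Z : {set 'I_n} | (D <= #|below n j :|: Z| < 2 * D)%N)
    (#|below n j :|: Z|)%:R ^+ #|Z| * p ^+ #|Z| *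
    (1 - p + p * kappa) ^+ (#|below n j :|: Z| * (n - #|below n j :|: Z|)).
Proof.
move=> n0 p01 k01; pose y0 := Ordinal n0.
pose W j Z : {set 'I_n} := below n j :|: Z.
have kb0 : 0 <= kappa ^+ b by apply: exprn_ge0; case/andP: k01 => /ltW.
apply: (@le_trans _ _ (kappa ^+ b * \sum_(j < n.+1) \sum_(Z : {set 'I_n} | (D <= #|W j Z| < 2 * D)%N)
  \sum_(g in pffun_on y0 (mem Z) (mem (W j Z))) Gnp_prob p (fun G => `[< closed_forest G D b j Z g >]))).
  apply: ler_wpM2l => //.
  apply: le_trans (@Gnp_prob_union _ _ _ p01 _ (fun=> true) _ (fun (j : 'I_n.+1) G => `[< exists Z g, closed_forest G D b j Z g >]) _) _.
    by move=> G /asboolP[j [Z [g [jn cf]]]]; exists (inord j) => //; apply/asboolP; exists Z, g; rewrite inordK.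
  apply: ler_sum => j _.
  apply: le_trans (@Gnp_prob_union _ _ _ p01 _ (fun Z => (D <= #|W j Z| < 2 * D)%N) _ (fun Z G => `[< exists g, closed_forest G D b j Z g >]) _) _.
    by move=> G /asboolP[Z [g cf]]; exists Z; [case: cf|apply/asboolP; exists g].
  apply: ler_sum => Z _.
  apply: (@Gnp_prob_union _ _ _ p01 _ (mem (pffun_on y0 (mem Z) (mem (W j Z))))).
  (* Outside [Z] the map is reset to the default [y0], as the count by [pffun_on] requires. *)
  move=> G /asboolP[g [h1 h2 h3 h4 h5]]; exists [ffun y => if y \in Z then g y else y0].
    apply/pffun_onP; split.
      by apply/subsetP => y; rewrite inE ffunE; case: ifP => //; rewrite eqxx.
    by move=> _ /imageP[y yZ ->]; have /h3[] := yZ; rewrite ffunE yZ.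
  apply/asboolP; split => // [y yZ|y z yZ zZ]; rewrite !ffunE yZ; first exact: h3.
  by rewrite zZ; apply: h4.
rewrite mulr_sumr; apply: ler_sum => j _; rewrite mulr_sumr; apply: ler_sum => Z _.
rewrite mulr_sumr -/(W j Z).
have -> : (n - #|W j Z|)%N = #|~: W j Z| by have := cardsC (W j Z); rewrite card_ord; lia.
apply: (@le_trans _ _ (\sum_(g in pffun_on y0 (mem Z) (mem (W j Z))) p ^+ #|Z| * (1 - p + p * kappa) ^+ (#|W j Z| * #|~: W j Z|))).
  by apply: ler_sum => g _; apply: Gnp_prob_closed_forest_fixed.
by rewrite sumr_const card_pffun_on -[leLHS]mulr_natl natrX mulrA.
Qed.

(** * The expected number of closed forests *)

Lemma expr_fact_le (x : R) m : 0 <= x -> x ^+ m / m`!%:R <= expR x.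
Proof.
case: m => [|m] x0; first by rewrite expr0 fact0 divr1 -[leLHS]expR0 ler_expR.
by apply: le_trans (expR_ge1Dxn m x0); rewrite lerDr.
Qed.

Lemma bin_le_fact n m : 'C(n, m)%:R <= n%:R ^+ m / m`!%:R :> R.
Proof.
rewrite ler_pdivlMr ?ltr0n ?fact_gt0 // -natrM bin_ffact -natrX ler_nat.
elim: m n => [|m IH] n; first by rewrite ffactn0.
case: n => [|n]; first by rewrite ffact0n.
rewrite ffactSS expnS leq_mul2l; apply/orP; right.
by apply: leq_trans (IH n) _; case: (m) => // k; rewrite leq_exp2r.
Qed.

(** The powers of [n] cancel, and [w ^+ z] over the factorial of [z] is at most [expR w], so
    choosing the forest costs at most [(c * expR 1) ^+ w]. The pairs leaving it contribute at most
    [expR (- (c * (1 - eta))) ^+ w]. *)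
Lemma closed_forest_term n (c kappa eta : R) z w : (0 < n)%N -> 1 <= c <= n%:R -> 0 <= kappa <= 1 ->
  (z <= w <= n)%N -> (1 - eta) * n%:R <= (1 - kappa) * (n - w)%:R ->
  'C(n, z)%:R * (w%:R ^+ z * (c / n%:R) ^+ z * (1 - c / n%:R + c / n%:R * kappa) ^+ (w * (n - w))) <=
  (c * expR (1 - c * (1 - eta))) ^+ w.
Proof.
move=> n0 /andP[c1 cn] /andP[k0 k1] /andP[zw wn] h.
have nR : 0 < n%:R :> R by rewrite ltr0n.
have c0 : 0 <= c by lra.
have p0 : 0 <= c / n%:R by rewrite divr_ge0.
have p1 : c / n%:R <= 1 by rewrite ler_pdivrMr // mul1r.
have q0 : 0 <= 1 - c / n%:R + c / n%:R * kappa by rewrite addr_ge0 ?subr_ge0 ?mulr_ge0.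
rewrite expRD [X in _ <= X ^+ w]mulrA [leRHS]exprMn [leLHS]mulrA; apply: ler_pM.
- by rewrite !mulr_ge0 ?exprn_ge0.
- exact: exprn_ge0.
- apply: (@le_trans _ _ (n%:R ^+ z / z`!%:R * (w%:R ^+ z * (c / n%:R) ^+ z))).
    by apply: ler_wpM2r; rewrite ?bin_le_fact // mulr_ge0 ?exprn_ge0.
  have -> : n%:R ^+ z / z`!%:R * (w%:R ^+ z * (c / n%:R) ^+ z) = c ^+ z * (w%:R ^+ z / z`!%:R) :> R.
    rewrite expr_div_n; field.
    by rewrite expf_neq0 ?gt_eqF // pnatr_eq0 -lt0n fact_gt0.
  rewrite exprMn; apply: ler_pM; rewrite ?exprn_ge0 ?divr_ge0 ?exprn_ge0 //.
    exact: ler_weXn2l.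
  by rewrite -expRM_natl mulr1; apply: expr_fact_le.
rewrite mulnC exprM; apply: lerXn2r; rewrite ?nnegrE ?exprn_ge0 ?expR_ge0 //.
apply: (@le_trans _ _ (expR (- (c / n%:R * (1 - kappa))) ^+ (n - w))).
  apply: lerXn2r; rewrite ?nnegrE ?expR_ge0 //.
  by apply: le_trans (expR_ge1Dx _); lra.
rewrite -expRM_natl ler_expR mulrN lerN2.
have -> : (n - w)%:R * (c / n%:R * (1 - kappa)) = c * ((1 - kappa) * (n - w)%:R) / n%:R by ring.
by rewrite ler_pdivlMr // -mulrA ler_wpM2l.
Qed.

(** Each [Z] is charged at most [t ^+ D] over the number of sets of its size, so each of the [n.+1]
    sizes contributes at most [t ^+ D], for each of the [n.+1] values of [j]. *)
Lemma sum_closed_forest n (c kappa eta : R) D : (0 < n)%N -> 1 <= c <= n%:R -> 0 <= kappa <= 1 ->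
  (2 * D <= n)%N -> (1 - eta) * n%:R <= (1 - kappa) * (n - 2 * D)%:R -> c * expR (1 - c * (1 - eta)) <= 1 ->
  \sum_(j < n.+1) \sum_(Z : {set 'I_n} | (D <= #|below n j :|: Z| < 2 * D)%N)
    (#|below n j :|: Z|)%:R ^+ #|Z| * (c / n%:R) ^+ #|Z| *
    (1 - c / n%:R + c / n%:R * kappa) ^+ (#|below n j :|: Z| * (n - #|below n j :|: Z|)) <=
  n.+1%:R ^+ 2 * (c * expR (1 - c * (1 - eta))) ^+ D.
Proof.
move=> n0 cn k01 Dn h t1; set t := c * expR _ in t1 *.
have t0 : 0 <= t by rewrite mulr_ge0 ?expR_ge0 //; case/andP: cn => *; lra.
have -> : n.+1%:R ^+ 2 * t ^+ D = \sum_(j < n.+1) (n.+1%:R * t ^+ D).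
  by rewrite sumr_const card_ord -[RHS]mulr_natl mulrA -expr2.
apply: ler_sum => j _.
apply: (@le_trans _ _ (\sum_(Z : {set 'I_n}) t ^+ D / 'C(n, #|Z|)%:R)).
  rewrite [leRHS](bigID (fun Z : {set 'I_n} => (D <= #|below n j :|: Z| < 2 * D)%N)) /=.
  rewrite -[leLHS]addr0; apply: lerD; last by apply: sumr_ge0 => Z _; rewrite divr_ge0 ?exprn_ge0.
  apply: ler_sum => Z /andP[DW WD]; set w := #|_ :|: _| in DW WD *.
  have Zn : (#|Z| <= n)%N by have := max_card (mem Z); rewrite card_ord.
  rewrite ler_pdivlMr ?ltr0n ?bin_gt0 // mulrC.
  apply: (@le_trans _ _ (t ^+ w)); last by apply: ler_wiXn2l.
  apply: closed_forest_term => //.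
    rewrite subset_leq_card ?subsetUr //=; exact: leq_trans (ltnW WD) Dn.
  apply: le_trans h _; apply: ler_wpM2l; first by case/andP: k01; rewrite subr_ge0.
  by rewrite ler_nat; lia.
rewrite (partition_big (fun Z : {set 'I_n} => inord #|Z| : 'I_n.+1) predT) //=.
have -> : n.+1%:R * t ^+ D = \sum_(z < n.+1) t ^+ D.
  by rewrite sumr_const card_ord -[RHS]mulr_natl.
apply: ler_sum => z _.
have zn : (z <= n)%N by rewrite -ltnS.
have zE (Z : {set 'I_n}) : (inord #|Z| == z) = (#|Z| == z :> nat).
  have Zn : (#|Z| < n.+1)%N by rewrite ltnS; have := max_card (mem Z); rewrite card_ord.
  by apply/eqP/eqP => [<-|e]; [rewrite inordK|apply: val_inj; rewrite /= inordK].
rewrite (eq_bigr (fun=> t ^+ D / 'C(n, z)%:R)) => [|Z]; last by rewrite zE => /eqP->.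
rewrite (eq_bigl (mem [set Z : {set 'I_n} | #|Z| == z])) => [|Z]; last by rewrite /= zE inE.
rewrite sumr_const card_draws card_ord -[leLHS]mulr_natl mulrC divfK //.
by rewrite pnatr_eq0 -lt0n bin_gt0.
Qed.

Local Open Scope classical_set_scope.

Lemma cvg_sqr_geometric (v : R) : 0 < v < 1 -> n.+1%:R ^+ 2 * v ^+ n @[n --> \oo] --> 0.
Proof.
case/andP=> v0 v1; pose u := 1 - (1 - v) / 3.
have u01 : 0 <= u < 1 by rewrite /u; apply/andP; split; lra.
have [u0 u1] := andP u01.
have vu : v <= u ^+ 3 by apply: le_cube_third; rewrite !ltW.
have up : 0 < u by rewrite /u; lra.
pose C := (1 - u)^-1 ^+ 2 / u ^+ 2.
apply: (@squeeze_cvgr _ _ _ _ (fun=> 0) (fun n => C * u ^+ n)).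
- near=> n; rewrite mulr_ge0 ?exprn_ge0 ?(ltW v0) //=.
  apply: (@le_trans _ _ (n.+1%:R ^+ 2 * (u ^+ 3) ^+ n)).
    by apply: ler_wpM2l; rewrite ?exprn_ge0 // lerXn2r // nnegrE ?exprn_ge0 // ltW.
  have -> : n.+1%:R ^+ 2 * u ^+ 3 ^+ n = (n.+1%:R * u ^+ n.+1) ^+ 2 / u ^+ 2 * u ^+ n.
    by rewrite -exprM mulnC exprM (exprS u n); field; rewrite gt_eqF.
  rewrite /C; apply: ler_wpM2r; first exact: exprn_ge0.
  apply: ler_wpM2r; first by rewrite invr_ge0 exprn_ge0.
  apply: lerXn2r; last exact: mulrn_expr_le.
    by rewrite nnegrE mulr_ge0 // exprn_ge0.
  by rewrite nnegrE invr_ge0 subr_ge0 ltW.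
- exact: cvg_cst.
rewrite -[X in _ --> X](mulr0 C); apply: cvgM; first exact: cvg_cst.
by apply: cvg_expr; rewrite ger0_norm.
Unshelve. all: by end_near.
Qed.

Lemma aas_rank_width_supercritical (c : R) : 1 < c -> exists2 r : R, 0 < r &
  aas (fun n => c / n%:R) (fun n G => r * n%:R <= (rank_width G)%:R).
Proof.
move=> c1; have c0 : 0 < c by lra.
have lnc : 0 < c - 1 - ln c.
  have := @expR_gt1Dx _ (ln c); rewrite lnK ?posrE // => /(_ _)/wrap[]; last by lra.
  by rewrite gt_eqF // ln_gt0.
(* [c * expR (1 - c)] equals [expR (- (2 * gam))]; the slack [eta] gives away half of this
   exponent. *)
pose gam := (c - 1 - ln c) / 2.
have gam0 : 0 < gam by rewrite /gam; lra.
pose eta := gam / c.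
have ln0 : 0 < ln c by apply: ln_gt0.
have eta01 : 0 < eta < 1 by rewrite divr_gt0 //= /eta ltr_pdivrMr // /gam; lra.
have tE : c * expR (1 - c * (1 - eta)) = expR (- gam).
  rewrite -{1}(lnK (_ : c \in Num.pos)) ?posrE // -expRD; congr expR.
  have -> : c * (1 - eta) = c - gam by rewrite /eta; field; rewrite gt_eqF.
  by rewrite /gam; lra.
(* [kappa] uses half of [eta]; the other half pays for [2 * D], since [d >= 4 / eta] gives
   [2 * D <= eta * n / 2]. *)
pose kappa := eta / 2.
have k01 : 0 < kappa <= 1 by rewrite /kappa; case/andP: eta01 => *; apply/andP; split; lra.
have v1 : expR (- (gam / 2)) < 1 by rewrite -[ltRHS]expR0 ltr_expR; lra.
(* As [M * b <= D], this gives [kappa ^+ b >= expR (- (gam / 2)) ^+ D], so dividing by [kappa ^+ b]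
   costs only half of the decay. *)
have [M hM] : exists M, expR (- (gam / 2)) ^+ M <= kappa.
  by apply: exists_expr_le; [rewrite expR_ge0|case/andP: k01].
have [d hd] : exists d : nat, 4 / eta <= d%:R.
  by exists (Num.truncn (4 / eta)).+1; apply: ltW; exact: truncnS_gt.
have [e0 e1] := andP eta01.
have d1 : (1 < d)%N.
  rewrite -(ltr_nat R); apply: lt_le_trans hd.
  by rewrite ltr_pdivlMr //; lra.
pose E2 := (6 * d * d * M.+1)%N; have E20 : (0 < E2)%N by rewrite /E2 !muln_gt0 (ltnW d1).
have c0' := ltW c0.
(* The constants are fixed backwards: [L2] from the bound [b2] on crossing edges, then [L1] from
   [b1 = n %/ L2]; the rank threshold is [n %/ L1]. The factors 2 absorb rounding. *)
have [L2 L20 sp2] := Gnp_prob_sparse (2 * E2) c0'.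
have [L1 L10 sp1] := Gnp_prob_sparse (2 * L2) c0'.
exists (L1%:R^-1); first by rewrite invr_gt0 ltr0n.
(* From [n <= 2 * d * D], the remaining decay [expR (- (gam / 2)) ^+ D] is at most [v ^+ n]. *)
pose v := expR (- (gam / (4 * d%:R))).
have dR : 0 < d%:R :> R by rewrite ltr0n ltnW.
have v01 : 0 < v < 1.
  rewrite expR_gt0 /= -[ltRHS]expR0 ltr_expR oppr_lt0 divr_gt0 // mulr_gt0 //.
apply: (@aas_of_bound _ _ _ (fun n => (1 / 2) ^+ n + (1 / 2) ^+ n + n.+1%:R ^+ 2 * v ^+ n)).
- near=> n; have n0 : (0 < n)%N by near: n; exists 1%N.
  have nc : c <= n%:R by near: n; apply: nbhs_infty_ger.
  by rewrite divr_ge0 //= ler_pdivrMr ?ltr0n // mul1r.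
- near=> n; have n2 : (2 < n)%N by near: n; exists 3%N.
  have nE2 : (E2 <= n)%N by near: n; exists E2.
  have nL2 : (L2 <= n)%N by near: n; exists L2.
  have nc : c <= n%:R by near: n; apply: nbhs_infty_ger.
  have n0 : (0 < n)%N by apply: leq_trans n2.
  have nR : 0 < n%:R :> R by rewrite ltr0n.
  have p1 : c / n%:R <= 1 by rewrite ler_pdivrMr // mul1r.
  have p01 : 0 <= c / n%:R <= 1 by rewrite p1 divr_ge0.
  have [D0n Dn2 dD MbD bD] := forest_parameters d1 nE2.
  move: (n %/ d)%N (n %/ (6 * d * d * M.+1))%N (@leq_double_divn E2 n) (leq_divM n d) D0n Dn2 dD MbD bD => D b2.
  rewrite E20 => /(_ nE2) b2n Dd D0n Dn2 dD MbD bD.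
  set b := (6 * d * b2)%N in MbD bD.
  have b1n : (n <= 2 * L2 * (n %/ L2))%N by apply: leq_double_divn; rewrite L20.
  move: (n %/ L2)%N (leq_divM n L2) b1n => b1 b1n' b1n.
  pose s := (n %/ L1)%N.
  (* If both sparsity conditions hold and the rank-width is small, [closed_forest_of_sparse]
     produces a closed forest. *)
  apply: le_trans (@Gnp_prob_or _ _ _ (fun G => `[< ~ sparse G s b1 >]) (fun G => `[< ~ sparse G b1 b2 >])
    (fun G : sgraph 'I_n => `[< exists j Z g, (j <= n)%N /\ closed_forest G D b j Z g >]) p01 _) _.
    move=> G /= rw; case: asboolP => //= /contrapT h1; case: asboolP => //= /contrapT h2.
    apply/asboolP; apply: (closed_forest_of_sparse n2 _ _ h1 h2).
    + exact: D0n.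
    + exact: bD.
    rewrite leqNgt; apply: contra rw => rw; rewrite mulrC ler_pdivrMr ?ltr0n // -natrM ler_nat.
    by apply: leq_trans (ltnW (ltn_ceil n L10)) _; rewrite leq_mul2r rw orbT.
  apply: lerD; first apply: lerD.
  + by apply: sp1 => //; rewrite mulnC leq_divM.
  + by apply: sp2 => //; rewrite mulnC.
  have P0 := Gnp_prob_ge0 p01 (fun G : sgraph 'I_n => `[< exists j Z g, (j <= n)%N /\ closed_forest G D b j Z g >]).
  have := Gnp_prob_closed_forest D b n0 p01 k01.
  set P := Gnp_prob _ _ in P0 * => hP.
  have := @sum_closed_forest n c kappa eta D n0 _ _ Dn2 _ _.
  rewrite tE => /(_ _ _ _ _)/wrap[].
  + by rewrite nc andbT ltW.
  + by case/andP: k01 => *; apply/andP; split; lra.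
  + rewrite natrB // natrM /kappa.
    have : 4 * D%:R <= eta * n%:R.
      apply: (@le_trans _ _ (eta * d%:R * D%:R)).
        by apply: ler_wpM2r => //; rewrite mulrC -ler_pdivrMr.
      by rewrite -mulrA; apply: ler_wpM2l; [exact: ltW|rewrite -natrM ler_nat mulnC]. 
    have : 0 <= D%:R :> R by [].
    move: (n%:R) (D%:R) => x y *; nra.
  + by rewrite -[leRHS]expR0 ler_expR; lra.
  move=> hS; have {hP hS} hP := le_trans hP hS.
  pose t := expR (- (gam / 2)).
  have t0 : 0 < t by apply: expR_gt0.
  have tt : expR (- gam) = t * t by rewrite /t -expRD; congr expR; lra.
  have kb : t ^+ D <= kappa ^+ b.
    apply: (@le_trans _ _ (t ^+ (M * b))); first by apply: ler_wiXn2l => //; rewrite ltW.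
    by rewrite exprM; apply: lerXn2r => //; rewrite nnegrE ?exprn_ge0 // ltW //; case/andP: k01.
  have {hP} : t ^+ D * P <= t ^+ D * (n.+1%:R ^+ 2 * t ^+ D).
    apply: le_trans (ler_wpM2r P0 kb) _; apply: le_trans hP _.
    by rewrite tt exprMn mulrCA.
  rewrite ler_pM2l ?exprn_gt0 // => /le_trans; apply.
  apply: ler_wpM2l; first exact: exprn_ge0.
  rewrite /t /v -!expRM_natl ler_expR.
  have -> : D%:R * - (gam / 2) = - (gam * (D%:R / 2)) by ring.
  have -> : n%:R * - (gam / (4 * d%:R)) = - (gam * (n%:R / (4 * d%:R))) by ring.
  rewrite lerN2 ler_pM2l // ler_pdivrMr ?mulr_gt0 //.
  have : n%:R <= 2 * d%:R * D%:R :> R by rewrite -!natrM ler_nat.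
  lra.
rewrite -[X in _ --> X](addr0 0) -{1}[X in X + _](addr0 0).
by apply: cvgD; [apply: cvgD; apply: cvg_expr; rewrite ger0_norm; lra|exact: cvg_sqr_geometric].
Unshelve. all: by end_near.
Qed.
End Supercritical.

Local Open Scope classical_set_scope.

Theorem theorem1p1 (R : realType) :
  [/\ (* (i) *)
      forall p : R, 0 < p < 1 ->
        exists C : R, aas (fun=> p) (fun n G =>
          `|(rank_width G)%:R - (Num.ceil (n%:R / 3 : R))%:~R| <= C),
      (* (ii) *)
      forall p : nat -> R, (forall n, 0 <= p n <= 1 / 2) ->
        (n%:R * p n @[n --> \oo] --> +oo) ->
        forall eps : R, 0 < eps ->
          aas p (fun n G =>
            `|(rank_width G)%:R - (Num.ceil (n%:R / 3 : R))%:~R| <= eps * n%:R),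
      (* (iii) *)
      forall c : R, 1 < c ->
        exists2 r : R, 0 < r &
          aas (fun n => c / n%:R) (fun n G => r * n%:R <= (rank_width G)%:R)
    & (* (iv) *)
      forall (c : R) (p : nat -> R), c < 1 ->
        (forall n, 0 <= p n <= 1) ->
        (forall n, (0 < n)%N -> p n <= c / n%:R) ->
        aas p (fun n G => (rank_width G <= 2)%N)].
Proof.
split.
- exact: aas_rank_width_constant.
- exact: aas_rank_width_sparse.
- exact: aas_rank_width_supercritical.
- exact: aas_rank_width_subcritical.
Qed.
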